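(* Let $X$ be a finite set with $n:=|X|\geq 3$, let $T$ be a fully-resolved $X$-tree, and let $\mathcal{L}$ be a stable triplet cover of $T$. Then: (i) the graph $(X,\mathcal{L})$ is a 2d-tree; (ii) $\mathcal{L}$ is a shellable lasso for $T$, and so $\mathcal{L}$ is a strong lasso for $T$; (iii) $|\mathcal{L}|=2n-3$, and so $\mathcal{L}$ is a minimal strong lasso for $T$ (i.e. no proper subset of $\mathcal{L}$ is a strong lasso for $T$).
   Context: An $X$-tree $T=(V,E)$ is a finite graph-theoretic tree whose leaf set is $X$ and which has no vertices of degree 2; it is fully-resolved if every interior (non-leaf) vertex has degree 3. Two $X$-trees $T=(V,E)$, $T'=(V',E')$ are equivalent if there is a bijection $V\to V'$ that is the identity on $X$ and is a graph isomorphism. For $Y\subseteq X$, $T|Y$ denotes the $Y$-tree obtained by restricting $T$ to $Y$ (taking the minimal subtree spanning $Y$ and suppressing degree-2 vertices). For distinct $a,b,c,d$, $T|\{a,b,c,d\}$ is the quartet tree $ab||cd$ if in it the path from $a$ to $b$ shares no vertex with the path from $c$ to $d$. Deleting an edge $e$ of $T$ splits $X$ into $A_e$ and $X-A_e$ (leaf sets of the two resulting components). An edge-weighting of $T$ is a map $w:E\to\mathbb{R}_{\ge 0}$; it is proper if it assigns nonzero weight to every edge not incident with a leaf. $d_{(T,w)}(x,y)$ is the sum of the weights of edges on the path between $x,y\in X$. A cord is a 2-element subset $\{a,b\}$ of $X$, written $ab$; $\binom{X}{2}$ is the set of all cords. For $\mathcal{L}\subseteq\binom{X}{2}$, $(X,\mathcal{L})$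 is the graph with vertex set $X$ and edge set $\mathcal{L}$. Two edge-weighted $X$-trees $(T,w),(T',w')$ are $\mathcal{L}$-isometric if $d_{(T,w)}(x,y)=d_{(T',w')}(x,y)$ for all $xy\in\mathcal{L}$. $\mathcal{L}$ is an edge-weight lasso for $T$ if for any proper edge-weightings $w,w'$ of $T$ with $(T,w),(T,w')$ $\mathcal{L}$-isometric, $w=w'$; a topological lasso for $T$ if for any $X$-tree $T'$ and proper edge-weightings $w$ of $T$ and $w'$ of $T'$ with $(T,w),(T',w')$ $\mathcal{L}$-isometric, $T$ and $T'$ are equivalent; a strong lasso if it is both. Shellable lasso: for $\mathcal{L}\subseteq\binom{X}{2}$ with $X=\bigcup\mathcal{L}$, $\mathcal{L}$ is a shellable lasso for $T$ if the cords of $\binom{X}{2}-\mathcal{L}$ can be ordered $a_1b_1,\dots,a_mb_m$ such that for every $\mu\in\{1,\dots,m\}$ there exist distinct $x_\mu,y_\mu\in X-\{a_\mu,b_\mu\}$ such that, with $Y_\mu=\{a_\mu,b_\mu,x_\mu,y_\mu\}$, $T|Y_\mu$ is the quartet tree $a_\mu x_\mu||y_\mu b_\mu$ and every cord in $\binom{Y_\mu}{2}$ other than $a_\mu b_\mu$ lies in $\mathcal{L}\cup\{a_{\mu'}b_{\mu'}:\mu'<\mu\}$. Stable triplet cover: let $\mathrm{clus}(T)=\bigcup_{e\in E}\{A_e,X-A_e\}$. A function $f:\mathrm{clus}(T)\to X$ is a stable transversal if $f(A)\in A$ for all $A\in\mathrm{clus}(T)$, and whenever $A,B\in\mathrm{clus}(T)$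 with $f(A)\in B\subseteq A$, then $f(A)=f(B)$. For each interior vertex $v$ of $T$ let $A^1_v,A^2_v,A^3_v$ be the leaf sets of the three components of $T-v$, and set $\mathcal{L}_{(T,f)}=\bigcup_{v}\{f(A^1_v)f(A^2_v),\,f(A^2_v)f(A^3_v),\,f(A^3_v)f(A^1_v)\}$, the union over interior vertices $v$. $\mathcal{L}$ is a stable triplet cover of $T$ if $\mathcal{L}=\mathcal{L}_{(T,f)}$ for some stable transversal $f$ of $\mathrm{clus}(T)$. A graph $G=(V,E)$ is a 2d-tree if there is an ordering $x_1,\dots,x_n$ of $V$ with $\{x_1,x_2\}\in E$ and, for each $i=3,\dots,n$, $x_i$ has degree 2 in the subgraph of $G$ induced by $\{x_1,\dots,x_i\}$. *)

(* Defs.v *)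
From HB Require Import structures.
From mathcomp Require Import all_boot all_order all_algebra.
From mathcomp Require Import reals.
Set Implicit Arguments. Unset Strict Implicit. Unset Printing Implicit Defensive.
Import Order.TTheory GRing.Theory Num.Theory.

(* X-trees.  A tree is given by a finite vertex type, a (simple, i.e.  *)
(* symmetric irreflexive) adjacency relation, and an injective map     *)
(* from the labels X onto the leaves of the tree.                       *)
Record Xtree (X : finType) := MkXtree {
  vt : finType;
  adj : rel vt;
  leaf : X -> vt }.
Arguments vt {X} x.
Arguments adj {X} x.
Arguments leaf {X} x.

Section Trees.
Variable X : finType.

Definition deg (T : Xtree X) (v : vt T) : nat := #|[set u | adj T v u]|.

Definition is_leaf_vertex (T : Xtree X) (v : vt T) : bool :=
  [exists x, leaf T x == v].

Definition is_Xtree (T : Xtree X) : Prop :=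
  [/\ symmetric (adj T), irreflexive (adj T) &
      (forall u v : vt T, connect (adj T) u v)] /\
  [/\
      (forall p : seq (vt T), uniq p -> 2 < size p -> ~~ cycle (adj T) p),
      injective (leaf T),
      (forall v : vt T, is_leaf_vertex v = (deg v <= 1)%N) &
      (forall v : vt T, deg v != 2%N)].

Definition fully_resolved (T : Xtree X) : Prop :=
  forall v : vt T, ~~ is_leaf_vertex v -> deg v = 3%N.

Definition equiv_Xtree (T T' : Xtree X) : Prop :=
  exists f : vt T -> vt T', [/\ bijective f,
     (forall x, f (leaf T x) = leaf T' x) &
     (forall u v, adj T' (f u) (f v) = adj T u v)].

Definition is_edge (T : Xtree X) (s : {set vt T}) : Prop :=
  exists u v, adj T u v /\ s = [set u; v].

Definition simple_path (T : Xtree X) (a b : vt T) (p : seq (vt T)) : bool :=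
  [&& path (adj T) a p, last a p == b & uniq (a :: p)].

Variable R : realType.

(* an edge-weighting is a map on edges; we represent it as a map on    *)
(* vertex sets, only its values on edges being relevant.               *)
Definition weighting (T : Xtree X) := {set vt T} -> R.

Definition is_weighting (T : Xtree X) (w : weighting T) : Prop :=
  forall s, is_edge s -> (0 <= w s)%R.

Definition proper_weighting (T : Xtree X) (w : weighting T) : Prop :=
  is_weighting w /\
  forall u v : vt T, adj T u v -> ~~ is_leaf_vertex u -> ~~ is_leaf_vertex v ->
    (w [set u; v] != 0)%R.

Definition same_weighting (T : Xtree X) (w w' : weighting T) : Prop :=
  forall s, is_edge s -> w s = w' s.

Definition path_weight (T : Xtree X) (w : weighting T) (a : vt T)
  (p : seq (vt T)) : R :=
  (\sum_(uv <- zip (a :: p) p) w [set uv.1; uv.2])%R.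

(* d_(T,w)(x,y) = r : r is the weight of the (unique) path from x to y *)
Definition dist_is (T : Xtree X) (w : weighting T) (x y : X) (r : R) : Prop :=
  exists p, simple_path (leaf T x) (leaf T y) p /\ path_weight w (leaf T x) p = r.

Definition is_cord (c : {set X}) : bool := #|c| == 2%N.

Definition Lisometric (L : {set {set X}}) (T T' : Xtree X)
  (w : weighting T) (w' : weighting T') : Prop :=
  forall x y : X, x != y -> [set x; y] \in L ->
    forall r, dist_is w x y r <-> dist_is w' x y r.

Definition edge_weight_lasso (L : {set {set X}}) (T : Xtree X) : Prop :=
  forall w w' : weighting T, proper_weighting w -> proper_weighting w' ->
    Lisometric L w w' -> same_weighting w w'.

Definition topological_lasso (L : {set {set X}}) (T : Xtree X) : Prop :=
  forall (T' : Xtree X) (w : weighting T) (w' : weighting T'),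
    is_Xtree T' -> proper_weighting w -> proper_weighting w' ->
    Lisometric L w w' -> equiv_Xtree T T'.

Definition strong_lasso (L : {set {set X}}) (T : Xtree X) : Prop :=
  edge_weight_lasso L T /\ topological_lasso L T.

Definition minimal_strong_lasso (L : {set {set X}}) (T : Xtree X) : Prop :=
  strong_lasso L T /\ forall L' : {set {set X}}, L' \proper L -> ~ strong_lasso L' T.

(* Quartets: T|{a,b,c,d} = ab||cd, i.e. the a-b path and the c-d path  *)
(* share no vertex (checked in T).                        *)
Definition quartet (T : Xtree X) (a b c d : X) : Prop :=
  forall p q, simple_path (leaf T a) (leaf T b) p ->
    simple_path (leaf T c) (leaf T d) q ->
    ~~ has (mem (leaf T c :: q)) (leaf T a :: p).

Definition shellable_lasso (L : {set {set X}}) (T : Xtree X) : Prop :=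
  (forall c, c \in L -> is_cord c) /\
  (forall x : X, exists2 c, c \in L & x \in c) /\
  exists ms : seq {set X},
    [/\ uniq ms,
        (forall c, c \in ms = is_cord c && (c \notin L)) &
        forall mu, (mu < size ms)%N ->
          exists a b x y : X,
            [/\ nth set0 ms mu = [set a; b],
                uniq [:: a; b; x; y],
                quartet T a x y b &
                forall c, is_cord c -> c \subset [set a; b; x; y] ->
                  c != [set a; b] -> (c \in L) || (c \in take mu ms)]].

Definition rm_edge (T : Xtree X) (u v : vt T) : rel (vt T) :=
  [rel a b | adj T a b && ~~ (((a == u) && (b == v)) || ((a == v) && (b == u)))].

(* leaf set of the component containing v after deleting the edge uv;  *)
(* for u = interior vertex and v a neighbour, this is the leaf set of   *)
(* the component of T - u containing v.                                 *)
Definition side (T : Xtree X) (u v : vt T) : {set X} :=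
  [set x | connect (rm_edge u v) v (leaf T x)].

Definition clus (T : Xtree X) : {set {set X}} :=
  [set A | [exists u, exists v, adj T u v && (A == side u v)]].

Definition stable_transversal (T : Xtree X) (f : {set X} -> X) : Prop :=
  (forall A, A \in clus T -> f A \in A) /\
  (forall A B, A \in clus T -> B \in clus T -> f A \in B -> B \subset A ->
     f A = f B).

Definition L_Tf (T : Xtree X) (f : {set X} -> X) : {set {set X}} :=
  [set c | [exists v, exists u1, exists u2,
     [&& ~~ is_leaf_vertex v, adj T v u1, adj T v u2, u1 != u2 &
         c == [set f (side v u1); f (side v u2)]]]].

Definition stable_triplet_cover (L : {set {set X}}) (T : Xtree X) : Prop :=
  exists f, stable_transversal T f /\ L = L_Tf T f.

Definition twod_tree (L : {set {set X}}) : Prop :=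
  exists (x1 x2 : X) (s' : seq X),
    let s := [:: x1, x2 & s'] in
    [/\ uniq s, (forall x, x \in s), [set x1; x2] \in L &
        forall i, (2 <= i < size s)%N ->
          count (fun y => [set y; nth x1 s i] \in L) (take i s) = 2%N].

End Trees.

(* Main.v *)
Require Import Defs.
From HB Require Import structures.
From mathcomp Require Import all_boot all_order all_algebra.
From mathcomp Require Import reals zify lra.
Set Implicit Arguments. Unset Strict Implicit. Unset Printing Implicit Defensive.
Import Order.TTheory GRing.Theory Num.Theory.

(** The clusters of a fully-resolved tree form a binary system of pairwise
    compatible splits, and such systems can be shrunk: if [{a, b}] is a cherry
    with [f {a, b} = a], then [b] is joined in the cover to exactly two labels,
    [a] and [c := f (X - {a, b})], and deleting [b] leaves a stable cover of the
    system restricted to [X - b].  This gives the 2d-tree ordering and the count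
    [2n - 3]; the missing cords [bz] can be shelled last, since the cherry makes
    [ba||cz] a quartet.

    Twice the distance of two leaves is the total weight of the directed edges
    that separate them, so the four-point condition extends an isometry along the
    shelling to all cords.  Two isometric trees have pairwise compatible clusters,
    and a binary system is a maximal compatible one; the weight of an edge is read
    off four leaves, hence the clusters and the weights agree.  The clusters
    determine the tree: a vertex is the set of clusters containing it.

    A set of fewer than [2n - 3] cords is no edge-weight lasso, because the linear
    map from the [2n - 3] edge weights to the distances has a kernel. *)

(** * Binary split systems *)

Section SplitSystems.
Variable X : finType.
Implicit Types (Y A B D E : {set X}) (C : {set {set X}}) (f : {set X} -> X).

Definition compatible Y A B :=
  [|| A \subset B, B \subset A, [disjoint A & B] | Y \subset A :|: B].

Record binary_splits Y C : Prop := BinarySplits {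
  bs_sub : forall A, A \in C -> A \subset Y;
  bs_neq0 : forall A, A \in C -> A != set0;
  bs_compl : forall A, A \in C -> Y :\: A \in C;
  bs_singl : forall x, x \in Y -> [set x] \in C;
  bs_compat : forall A B, A \in C -> B \in C -> compatible Y A B;
  bs_split : forall A, A \in C -> 1 < #|A| -> exists B D,
    [/\ B \in C, D \in C, A = B :|: D & [disjoint B & D]] }.

Definition stable_on C f :=
  (forall A, A \in C -> f A \in A) /\
  (forall A B, A \in C -> B \in C -> f A \in B -> B \subset A -> f A = f B).

(* The alternative [A :|: B == Y] adds no cord as soon as [2 < #|Y|], and gives
   the single cord [Y] when [#|Y| = 2], which starts the induction. *)
Definition cords Y C f : {set {set X}} :=
  [set c | [exists A in C, exists B in C,
     [&& [disjoint A & B], (A :|: B == Y) || (Y :\: (A :|: B) \in C) &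
         c == [set f A; f B]]]].

Lemma cordsP Y C f c :
  reflect (exists A B, [/\ A \in C, B \in C, [disjoint A & B],
             (A :|: B == Y) || (Y :\: (A :|: B) \in C) & c = [set f A; f B]])
          (c \in cords Y C f).
Proof.
rewrite inE; apply: (iffP exists_inP) => [[A AC] /exists_inP[B BC]|].
  by case/and3P=> dAB cY /eqP->; exists A, B; split.
case=> A [B [AC BC dAB cY ->]]; exists A => //; apply/exists_inP.
by exists B => //; rewrite dAB cY eqxx.
Qed.

Lemma compatible_cross Y A B a b c d : compatible Y A B ->
  a \in A -> a \in B -> b \in A -> b \notin B -> c \notin A -> c \in B ->
  d \in Y -> d \notin A -> d \notin B -> False.
Proof.
move=> cAB aA aB bA bB cA cB dY dA dB; case/or4P: cAB.
- by move/subsetP/(_ _ bA); rewrite (negbTE bB).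
- by move/subsetP/(_ _ cB); rewrite (negbTE cA).
- by rewrite disjoint_subset=> /subsetP/(_ _ aA); rewrite !inE aB.
- by move/subsetP/(_ _ dY); rewrite !inE (negbTE dA) (negbTE dB).
Qed.

Lemma disjointF A B x : [disjoint A & B] -> x \in A -> x \in B -> False.
Proof.
by rewrite disjoint_subset=> /subsetP dAB /dAB; rewrite !inE => /negP.
Qed.

Section System.
Variables (Y : {set X}) (C : {set {set X}}).
Hypothesis bsC : binary_splits Y C.

Lemma bs_inY A x : A \in C -> x \in A -> x \in Y.
Proof. by move=> /(bs_sub bsC)/subsetP; apply. Qed.

Lemma bs_outP A : A \in C -> exists2 x, x \in Y & x \notin A.
Proof.
move=> /(bs_compl bsC)/(bs_neq0 bsC)/set0Pn[x]; rewrite inE => /andP[xA xY].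
by exists x.
Qed.

Lemma bs_maximal A : A != set0 -> A \proper Y ->
  (forall B, B \in C -> compatible Y A B) -> A \in C.
Proof.
move=> /set0Pn[x0 x0A] /properP[sAY [y yY yA]] cA.
pose P := [pred B : {set X} | (B \in C) && (A \subset B)].
have P0 : P (Y :\ y).
  rewrite inE /= (bs_compl bsC) // ?(bs_singl bsC) //; apply/subsetP=> z zA.
  rewrite !inE (subsetP sAY) // andbT; apply: contraNneq yA => <- //.
have [B /andP[BC sAB] minB] := arg_minnP (fun B : {set X} => #|B|) P0.
have [|ltB] := leqP #|B| 1.
  rewrite leq_eqVlt ltnS leqn0 cards_eq0 (negbTE (bs_neq0 bsC BC)) orbF => /cards1P[b eB].
  suff -> : A = B by [].
  apply/eqP; rewrite eqEsubset sAB eB sub1set.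
  by move: (x0A) => /(subsetP sAB); rewrite eB inE => /eqP<-.
have [B1 [B2 [B1C B2C eB dB]]] := bs_split bsC BC ltB.
have B1n : forall D E, D \in C -> E \in C -> B = D :|: E -> [disjoint D & E] ->
    ~~ (A \subset D).
  move=> D E DC EC eDE dDE; apply/negP=> sAD.
  have := minB D; rewrite /= DC sAD => /(_ isT); apply/negP; rewrite -ltnNge.
  apply: proper_card; rewrite eDE; apply/properP; split; first exact: subsetUl.
  have [z zE] := set0Pn _ (bs_neq0 bsC EC); exists z; first by rewrite inE zE orbT.
  by apply/negP => zD; exact: disjointF dDE zD zE.
have sub : forall D E, D \in C -> E \in C -> B = D :|: E -> [disjoint D & E] ->
    D \subset A.
  move=> D E DC EC eDE dDE; have := cA D DC; case/or4P => //.
  - by rewrite (negbTE (B1n _ _ DC EC eDE dDE)).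
  - move=> dAD; have : A \subset E.
      apply/subsetP=> z zA; have := subsetP sAB _ zA; rewrite eDE inE.
      by case/orP => // /(disjointF dAD zA).
    by rewrite (negbTE (B1n _ _ EC DC _ _)) // 1?setUC // disjoint_sym.
  move=> sY; have [z zY zB] := bs_outP BC.
  have := subsetP sY _ zY; rewrite inE => /orP[/(subsetP sAB)|zD].
    by rewrite (negbTE zB).
  by move: zB; rewrite eDE inE zD.
suff -> : A = B by [].
apply/eqP; rewrite eqEsubset sAB {1}eB subUset (sub _ _ B1C B2C) //.
by rewrite (sub _ _ B2C B1C) // 1?setUC // disjoint_sym.
Qed.

Lemma bs_split_compat A B E : A \in C -> B \in C -> E \in C -> [disjoint A & B] ->
  A :|: B \proper Y -> E \subset A :|: B -> E != A :|: B ->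
  E \subset A \/ E \subset B.
Proof.
move=> AC BC EC dAB pAB sE nE.
have [y yY] : exists2 y, y \in Y & y \notin A :|: B by case/properP: pAB.
rewrite inE negb_or => /andP[yA yB].
have yE : y \notin E.
  by apply/negP=> /(subsetP sE); rewrite inE (negbTE yA) (negbTE yB).
have [sEA|/subsetPn[z zE zA]] := boolP (E \subset A); first by left.
have [sEB|/subsetPn[t tE tB]] := boolP (E \subset B); first by right.
have zB : z \in B by have := subsetP sE _ zE; rewrite inE (negbTE zA).
have tA : t \in A by have := subsetP sE _ tE; rewrite inE (negbTE tB) orbF.
case/negP: nE; rewrite eqEsubset sE subUset /=; apply/andP; split.
  apply/subsetP=> u uA; apply/negPn/negP=> uE.
  by apply: (compatible_cross (bs_compat bsC EC AC) tE tA zE zA uE uA yY).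
apply/subsetP=> u uB; apply/negPn/negP=> uE.
by apply: (compatible_cross (bs_compat bsC EC BC) zE zB tE tB uE uB yY).
Qed.

End System.

Lemma bs_cherry Y C f : binary_splits Y C -> stable_on C f -> 2 < #|Y| ->
  exists a b, [/\ a != b, a \in Y, b \in Y, [set a; b] \in C & f [set a; b] = a].
Proof.
move=> bsC [fin _] Y3.
have [x xY] : exists x, x \in Y by apply/set0Pn; rewrite -card_gt0; lia.
pose P := [pred B : {set X} | (B \in C) && (1 < #|B|)].
have P0 : P (Y :\ x).
  by rewrite inE /= (bs_compl bsC) ?(bs_singl bsC) // cardsDS ?sub1set // cards1; lia.
have [A /andP[AC ltA] minA] := arg_minnP (fun B : {set X} => #|B|) P0.
have [B [D [BC DC eA dBD]]] := bs_split bsC AC ltA.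
have card1 E : E \in C -> #|E| < #|A| -> #|E| == 1.
  move=> EC ltE; move: (bs_neq0 bsC EC); rewrite -card_gt0 => E0.
  have := minA E; rewrite /= EC /=; lia.
have cA : #|A| = #|B| + #|D|.
  by rewrite eA cardsU (disjoint_setI0 dBD) cards0 subn0.
move: (bs_neq0 bsC BC) (bs_neq0 bsC DC); rewrite -!card_gt0 => B0 D0.
have /cards1P[a eB] : #|B| == 1 by apply: card1 => //; lia.
have /cards1P[b eD] : #|D| == 1 by apply: card1 => //; lia.
have ab : a != b.
  apply/eqP=> ab; apply: (@disjointF _ _ a dBD); first by rewrite eB inE.
  by rewrite eD inE ab.
have eA' : A = [set a; b] by rewrite eA eB eD.
have aY : a \in Y by apply: (bs_inY bsC AC); rewrite eA' !inE eqxx.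
have bY : b \in Y by apply: (bs_inY bsC AC); rewrite eA' !inE eqxx orbT.
have := fin _ AC; rewrite eA' !inE => /orP[]/eqP fA.
  by exists a, b; split; rewrite // -eA'.
by exists b, a; rewrite setUC eq_sym; split; rewrite // -eA'.
Qed.

Lemma bs_separate Y C a b E : binary_splits Y C -> [set a; b] \in C -> E \in C ->
  a \in E -> b \notin E -> E = [set a] \/ E = Y :\ b.
Proof.
move=> bsC abC EC aE bE; case/or4P: (bs_compat bsC abC EC).
- by move/subsetP/(_ b); rewrite !inE eqxx orbT (negbTE bE) => /(_ isT).
- move/subsetP=> sE; left; apply/setP=> z; rewrite inE; apply/idP/eqP=> [zE|->//].
  have := sE _ zE; rewrite !inE => /orP[/eqP//|/eqP zb].
  by rewrite -zb zE in bE.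
- by move=> d; case: (disjointF d (_ : a \in _) aE); rewrite !inE eqxx.
- move/subsetP=> sY; right; apply/setP=> z; rewrite !inE; apply/idP/andP=> [zE|[zb zY]].
    by rewrite (bs_inY bsC EC zE); split=> //; apply: contraNneq bE => <-.
  have := sY _ zY; rewrite !inE (negbTE zb) orbF => /orP[/eqP->|] //.
Qed.

Section Reduction.
Variables (Y : {set X}) (C : {set {set X}}) (f : {set X} -> X) (a b : X).
Hypotheses (bsC : binary_splits Y C) (stf : stable_on C f) (Y3 : 2 < #|Y|).
Hypotheses (ab : a != b) (aY : a \in Y) (bY : b \in Y).
Hypotheses (abC : [set a; b] \in C) (fab : f [set a; b] = a).

(* Inverts the deletion of [b] on sets that do not separate [a] from [b]. *)
Definition glue A := if a \in A then b |: A else A.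
Let Y' := Y :\ b.
Let C' := [set A : {set X} | (A \subset Y') && (glue A \in C)].
Let f' := fun A => f (glue A).
Let c := f (Y :\: [set a; b]).

Let ba : b != a. Proof. by rewrite eq_sym. Qed.

Let notin_b A : A \subset Y' -> (b \in A) = false.
Proof. by move=> /subsetP sA; apply/negP=> /sA; rewrite !inE eqxx. Qed.

Lemma in_glue A z : A \subset Y' -> (z \in glue A) = (if z == b then a \in A else z \in A).
Proof.
move=> /subsetP sA; rewrite /glue; case: ifP => aA; rewrite ?inE; case: eqP => // ->.
by apply/negP=> /sA; rewrite !inE eqxx.
Qed.

Lemma glueE E : E \subset Y -> (a \in E) = (b \in E) -> glue (E :\ b) = E.
Proof.
move=> sE abE; apply/setP=> z; rewrite in_glue ?setSD // !inE ab /=.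
by case: eqP => // ->.
Qed.

Let stable_mem E : E \in C -> f E \in E. Proof. by case: stf => fin _ /fin. Qed.

Let f1 x : x \in Y -> f [set x] = x.
Proof. by move=> xY; have := stable_mem (bs_singl bsC xY); rewrite inE => /eqP. Qed.

Lemma value_b E : E \in C -> f E = b -> E = [set b] \/ E = Y :\ a.
Proof.
move=> EC fE; have bE : b \in E by rewrite -fE stable_mem.
have [aE|aE] := boolP (a \in E); last first.
  by apply: (bs_separate bsC _ EC bE aE); rewrite setUC.
have sE : [set a; b] \subset E by rewrite subUset !sub1set aE bE.
case: stf => _ /(_ _ _ EC abC); rewrite fE fab !inE eqxx orbT => /(_ isT sE) ba'.
by move: ab; rewrite ba' eqxx.
Qed.

Let restC : Y :\: [set a; b] \in C. Proof. exact: bs_compl bsC _ _. Qed.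

Lemma c_mem : [/\ c \in Y, c != a & c != b].
Proof.
have := stable_mem restC; rewrite -/c !inE negb_or => /andP[/andP[-> ->] ->].
by [].
Qed.

Let value_Ya : f (Y :\ a) != b -> f (Y :\ a) = c.
Proof.
move=> nb; have YaC : Y :\ a \in C by rewrite (bs_compl bsC) ?(bs_singl bsC).
case: stf => _; apply=> //; last by rewrite setDUr subsetIl.
by have := stable_mem YaC; rewrite !inE (negbTE nb) orbF.
Qed.

Let value_Yb : f (Y :\ b) != a -> f (Y :\ b) = c.
Proof.
move=> na; have YbC : Y :\ b \in C by rewrite (bs_compl bsC) ?(bs_singl bsC).
case: stf => _; apply=> //; last by rewrite setDUr subsetIr.
by have := stable_mem YbC; rewrite !inE (negbTE na).
Qed.

Let glueU A B : glue (A :|: B) = glue A :|: glue B.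
Proof.
apply/setP=> z; rewrite /glue !inE.
by case: (a \in A); case: (a \in B); rewrite /= !inE; case: (z == b); rewrite /= ?orbT.
Qed.

Let glueD A : A \subset Y' -> glue (Y' :\: A) = Y :\: glue A.
Proof.
move=> sA; apply/setP=> z; rewrite in_glue ?subsetDl // !inE in_glue //.
by case: eqP => [->|_]; rewrite ?aY ?bY ?ab ?andbT.
Qed.

Lemma reduced_splits : binary_splits Y' C'.
Proof.
split.
- by move=> A; rewrite inE => /andP[].
- move=> A; rewrite inE => /andP[_ /(bs_neq0 bsC)]; apply: contraNneq => ->.
  by rewrite /glue inE.
- by move=> A; rewrite !inE subsetDl => /andP[sA gA]; rewrite glueD // (bs_compl bsC).
- move=> x; rewrite !inE => /andP[xb xY]; rewrite sub1set !inE xb xY /glue inE.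
  by case: eqP => [<-|_]; [rewrite setUC | apply: bs_singl bsC _ xY].
- move=> A B; rewrite !inE => /andP[sA gA] /andP[sB gB].
  have gluesub D E : D \subset Y' -> E \subset Y' -> glue D \subset glue E -> D \subset E.
    move=> sD sE /subsetP sDE; apply/subsetP=> z zD; have := sDE z.
    have : z != b by move: (subsetP sD _ zD); rewrite !inE => /andP[].
    by rewrite !in_glue // => /negbTE->; apply.
  case/or4P: (bs_compat bsC gA gB).
  + by move/(gluesub _ _ sA sB) => s; rewrite /compatible s.
  + by move/(gluesub _ _ sB sA) => s; rewrite /compatible s orbT.
  + move=> d; apply/or4P/Or43; rewrite disjoint_subset; apply/subsetP=> z zA.
    have zb : z != b by move: (subsetP sA _ zA); rewrite !inE => /andP[].
    rewrite inE; apply/negP=> zB; apply: (@disjointF _ _ z d);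
      by rewrite in_glue // (negbTE zb).
  + move=> sY; apply/or4P/Or44; apply: gluesub; rewrite ?subUset ?sA ?sB //.
    rewrite glueU; apply: subset_trans sY; apply/subsetP=> z.
    by rewrite in_glue // !inE ab aY /=; case: eqP => // ->.
- move=> A; rewrite inE => /andP[sA gA] A2.
  have sAg : A \subset glue A by rewrite /glue; case: ifP => // _; exact: subsetUr.
  have g2 : 1 < #|glue A| by apply: leq_trans A2 _; exact: subset_leq_card.
  have [B [D [BC DC eg d]]] := bs_split bsC gA g2.
  have [y yY yg] := bs_outP bsC gA.
  have abg : (a \in glue A) = (b \in glue A) by rewrite !in_glue // eqxx (negbTE ab).
  have key E F : E \in C -> F \in C -> glue A = E :|: F -> [disjoint E & F] ->
      a \in E -> b \in E.
    move=> EC FC eEF dEF aE; apply/negPn/negP=> bE.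
    have bF : b \in F.
      by move: abg; rewrite eEF !inE aE (negbTE bE) /= => <-.
    have aF : a \notin F by apply/negP=> /(disjointF dEF aE).
    have baC : [set b; a] \in C by rewrite setUC.
    have gY x : x \in Y -> E :|: F = Y -> False.
      by move=> _ eY; move: yg; rewrite eEF eY yY.
    case: (bs_separate bsC abC EC aE bE) => eE; last first.
      apply: (gY _ aY); apply/eqP; rewrite eqEsubset subUset !(bs_sub bsC) //=.
      by rewrite eE; apply/subsetP=> z zY; rewrite !inE zY andbT; case: eqP => // ->.
    case: (bs_separate bsC baC FC bF aF) => eF; last first.
      apply: (gY _ aY); apply/eqP; rewrite eqEsubset subUset !(bs_sub bsC) //=.
      by rewrite eE eF; apply/subsetP=> z zY; rewrite !inE zY andbT; case: eqP.
    have : A \subset [set a].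
      apply/subsetP=> z zA; have zb : z != b by move: (subsetP sA _ zA); rewrite !inE => /andP[].
      by have := subsetP sAg _ zA; rewrite eEF eE eF !inE (negbTE zb) orbF.
    by move/subset_leq_card; rewrite cards1 leqNgt A2.
  have keyb E F : E \in C -> F \in C -> glue A = E :|: F -> [disjoint E & F] ->
      (a \in E) = (b \in E).
    move=> EC FC eEF dEF; apply/idP/idP; first exact: (key E F).
    move=> bE; apply/negPn/negP=> aE.
    have aF : a \in F.
      have : a \in glue A by rewrite abg eEF inE bE.
      by rewrite eEF inE (negbTE aE).
    have bF : b \in F by apply: (key F E) => //; rewrite 1?setUC // disjoint_sym.
    exact: disjointF dEF bE bF.
  have kB := keyb _ _ BC DC eg d.
  have kD : (a \in D) = (b \in D).
    by apply: (keyb D B) => //; rewrite 1?setUC // disjoint_sym.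
  exists (B :\ b), (D :\ b); split.
  + by rewrite inE glueE ?BC ?(bs_sub bsC) // setSD // (bs_sub bsC).
  + by rewrite inE glueE ?DC ?(bs_sub bsC) // setSD // (bs_sub bsC).
  + rewrite -setDUl -eg; apply/setP=> z; rewrite !inE in_glue //.
    by case: eqP => //= ->; apply/negP=> /(subsetP sA); rewrite !inE eqxx.
  + apply: disjointWl (subsetDl _ _) _; apply: disjointWr (subsetDl _ _) _; exact: d.
Qed.

Let glue_value A : A \in C' -> f (glue A) \in A.
Proof.
rewrite inE => /andP[sA gA]; have := stable_mem gA; rewrite in_glue //.
case: eqP => // fb aA; case: (value_b gA fb) => /setP/(_ a).
  by rewrite in_glue // (negbTE ab) aA !inE (negbTE ab).
by rewrite in_glue // (negbTE ab) aA !inE eqxx.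
Qed.

Lemma reduced_stable : stable_on C' f'.
Proof.
split; first exact: glue_value.
move=> A B AC BC fAB sBA; have := glue_value BC.
move: AC BC; rewrite !inE => /andP[sA gA] /andP[sB gB] _.
case: stf => _; apply=> //.
  rewrite in_glue // (_ : (_ == b) = false) //; apply/negP=> /eqP fb.
  by move: (subsetP sB _ fAB); rewrite /f' fb !inE eqxx.
by apply/subsetP=> z; rewrite !in_glue //; case: ifP => _ /(subsetP sBA).
Qed.

Lemma reduced_lift A : A \in C' -> exists2 B, B \in C & forall z, z \in Y' -> (z \in B) = (z \in A).
Proof.
rewrite inE => /andP[sA gA]; exists (glue A) => // z.
by rewrite !inE in_glue // => /andP[/negbTE->].
Qed.

Lemma reduced_card : #|C'| + 4 <= #|C|.
Proof.
have sub : glue @: C' \subset C.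
  by apply/subsetP=> _ /imsetP[A hA ->]; move: hA; rewrite inE => /andP[].
have gi : {in C' &, injective glue}.
  move=> A B; rewrite !inE => /andP[sA _] /andP[sB _] /setP e; apply/setP=> z.
  have := e z; rewrite !in_glue //; case: eqP => // -> _.
  by rewrite !notin_b.
rewrite -(card_in_imset gi).
have [cY ca cb] := c_mem.
pose N := [set [set a]; [set b]; Y :\ a; Y :\ b].
have NC : N \subset C.
  by rewrite !subUset !sub1set !(bs_compl bsC) ?(bs_singl bsC).
have dN : [disjoint N & glue @: C'].
  rewrite disjoint_subset; apply/subsetP=> E; rewrite inE => EN.
  apply/negP=> /imsetP[A]; rewrite inE => /andP[sA _] eE.
  have : (a \in E) = (b \in E) by rewrite eE !in_glue // eqxx (negbTE ab).
  by move: EN; rewrite !inE -!orbA => /or4P[]/eqP->;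
    rewrite !inE ?eqxx ?aY ?bY ?(negbTE ab) ?(negbTE ba).
have cN : #|N| = 4.
  rewrite /N -!setUA !cardsU1 cards1 !inE.
  have n1 : [set a] != [set b] by apply/eqP=> /setP/(_ a); rewrite !inE eqxx (negbTE ab).
  have n2 : [set a] != Y :\ a by apply/eqP=> /setP/(_ a); rewrite !inE eqxx.
  have n3 : [set a] != Y :\ b by apply/eqP=> /setP/(_ c); rewrite !inE cY (negbTE ca) cb.
  have n4 : [set b] != Y :\ a by apply/eqP=> /setP/(_ c); rewrite !inE cY (negbTE cb) ca.
  have n5 : [set b] != Y :\ b by apply/eqP=> /setP/(_ b); rewrite !inE eqxx.
  have n6 : Y :\ a != Y :\ b by apply/eqP=> /setP/(_ b); rewrite !inE bY eqxx ba.
  by rewrite (negbTE n1) (negbTE n2) (negbTE n3) (negbTE n4) (negbTE n5) (negbTE n6).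
rewrite addnC -cN -(_ : #|N :|: glue @: C'| = #|N| + #|glue @: C'|).
  by apply: subset_leq_card; rewrite subUset NC sub.
by rewrite cardsU (disjoint_setI0 dN) cards0 subn0.
Qed.


Lemma cord_b A B : A \in C -> B \in C -> [disjoint A & B] ->
  (A :|: B == Y) || (Y :\: (A :|: B) \in C) -> f A = b -> f B = a \/ f B = c.
Proof.
move=> hA hB dAB cY fA; case: (value_b hA fA) => eA; last first.
  left; apply/eqP; apply: contraT => nB; case: (disjointF dAB (_ : f B \in A) _).
    by rewrite eA !inE nB (bs_inY bsC hB) ?stable_mem.
  exact: stable_mem.
have bB : b \notin B by apply/negP; apply: disjointF dAB _; rewrite eA inE.
have [aB|aB] := boolP (a \in B).
  case: (bs_separate bsC abC hB aB bB) => ->; first by left; rewrite f1.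
  by case: (eqVneq (f (Y :\ b)) a) => [|/value_Yb]; [left | right].
have aAB : a \notin A :|: B by rewrite eA !inE (negbTE ab).
case/orP: cY => [/eqP eY|hD]; first by rewrite eY aY in aAB.
have aD : a \in Y :\: (A :|: B) by rewrite inE aAB.
have bD : b \notin Y :\: (A :|: B) by rewrite eA !inE eqxx.
case: (bs_separate bsC abC hD aD bD) => /setP eD; last first.
  have [z zB] := set0Pn _ (bs_neq0 bsC hB); have := eD z.
  have zb : z != b by apply: contraNneq bB => <-.
  by rewrite !inE zB orbT zb (bs_inY bsC hB zB).
right; congr (f _); apply/setP=> z; have := eD z; rewrite eA !inE.
have [->|za] := eqVneq z a; first by rewrite (negbTE aB).
have [->|zb] := eqVneq z b; first by rewrite (negbTE bB).
by have := subsetP (bs_sub bsC hB) z; case: (z \in B) => [->|_] //=; case: (z \in Y).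
Qed.

Lemma cord_sep A B : A \in C -> B \in C -> [disjoint A & B] ->
  (A :|: B == Y) || (Y :\: (A :|: B) \in C) -> f A != b -> f B != b ->
  (a \in A) != (b \in A) -> [set f A; f B] = [set a; c].
Proof.
move=> hA hB dAB cY fA fB sep.
have baC : [set b; a] \in C by rewrite setUC.
have fBA : f B \notin A by apply/negP=> /(disjointF dAB); apply; exact: stable_mem.
have fBY : f B \in Y by apply: (bs_inY bsC hB); exact: stable_mem.
have [aA|aA] := boolP (a \in A); last first.
  have bA : b \in A by move: sep; rewrite (negbTE aA); case: (b \in A).
  case: (bs_separate bsC baC hA bA aA) => eA; first by rewrite eA f1 // eqxx in fA.
  rewrite eA value_Ya -?eA // setUC; congr ([set _; _]); apply/eqP.
  by move: fBA; rewrite eA !inE fBY andbT negbK.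
have bA : b \notin A by move: sep; rewrite aA; case: (b \in A).
case: (bs_separate bsC abC hA aA bA) => eA; last first.
  by move: fBA; rewrite eA !inE fBY andbT negbK (negbTE fB).
rewrite eA f1 //; congr ([set _; _]).
have aB : a \notin B by apply/negP; exact: disjointF dAB aA.
have [bB|bB] := boolP (b \in B).
  case: (bs_separate bsC baC hB bB aB) => eB; first by rewrite eB f1 // eqxx in fB.
  by rewrite eB value_Ya // -eB.
have bAB : b \notin A :|: B by rewrite inE negb_or bA.
case/orP: cY => [/eqP eY|hD]; first by rewrite eY bY in bAB.
have bD : b \in Y :\: (A :|: B) by rewrite inE bAB.
have aD : a \notin Y :\: (A :|: B) by rewrite !inE aA.
case: (bs_separate bsC baC hD bD aD) => /setP eD; last first.
  have [z zB] := set0Pn _ (bs_neq0 bsC hB); have := eD z.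
  have za : z != a by apply: contraNneq aB => <-.
  by rewrite !inE zB orbT za (bs_inY bsC hB zB).
congr (f _); apply/setP=> z; have := eD z; rewrite eA !inE.
have [->|za] := eqVneq z a; first by rewrite (negbTE aB).
have [->|zb] := eqVneq z b; first by rewrite (negbTE bB).
by have := subsetP (bs_sub bsC hB) z; case: (z \in B) => [->|_] //=; case: (z \in Y).
Qed.

Lemma reduced_cords : cords Y C f = [set a; b] |: ([set b; c] |: cords Y' C' f').
Proof.
have [cY ca cb] := c_mem.
apply/setP=> s; rewrite !in_setU1; apply/idP/idP; last first.
  case/or3P=> [/eqP->|/eqP->|].
  - apply/cordsP; exists [set a], [set b]; rewrite !f1 // !(bs_singl bsC) //; split=> //.
      by rewrite disjoints1 inE.
    by rewrite restC orbT.
  - apply/cordsP; exists [set b], (Y :\: [set a; b]); rewrite !f1 // (bs_singl bsC) //.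
    split=> //; first by rewrite disjoints1 !inE eqxx orbT.
    rewrite (_ : Y :\: ([set b] :|: _) = [set a]) ?(bs_singl bsC) ?orbT //.
    apply/setP=> z; rewrite !inE; have [->|zb] := eqVneq z b; first by rewrite (negbTE ba).
    by have [->|za] := eqVneq z a; rewrite ?aY //=; case: (z \in Y).
  case/cordsP=> A [B [hA hB dAB cov ->]]; apply/cordsP; exists (glue A), (glue B).
  move: hA hB; rewrite !inE => /andP[sA gA] /andP[sB gB]; split=> //.
    rewrite disjoint_subset; apply/subsetP=> z; rewrite inE !in_glue //.
    by case: ifP => _ zA; apply/negP; exact: disjointF dAB zA.
  case/orP: cov => [/eqP eY|].
    rewrite -glueU eY (_ : glue Y' = Y) ?eqxx //; apply/setP=> z; rewrite in_glue // !inE.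
    by case: eqVneq => [->|] //; rewrite ab aY bY.
  by rewrite inE -glueU glueD ?subUset ?sA // => /andP[_ ->]; rewrite orbT.
case/cordsP=> A [B [hA hB dAB cov ->]].
have dBA : [disjoint B & A] by rewrite disjoint_sym.
have cov' : (B :|: A == Y) || (Y :\: (B :|: A) \in C) by rewrite setUC.
have [fA|fA] := eqVneq (f A) b.
  have [|] := cord_b hA hB dAB cov fA => ->; rewrite fA ?eqxx ?orbT //.
  by rewrite setUC eqxx.
have [fB|fB] := eqVneq (f B) b.
  have [|] := cord_b hB hA dBA cov' fB => ->; rewrite fB ?eqxx ?orbT //.
  by rewrite [X in X == [set b; c]]setUC eqxx orbT.
apply/orP; right; apply/orP; right.
have acL : [set a; c] \in cords Y' C' f'.
  apply/cordsP; exists [set a], (Y' :\ a).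
  have aC' : [set a] \in C' by rewrite (bs_singl reduced_splits) // !inE ab.
  have ga : glue [set a] = [set a; b] by rewrite /glue inE eqxx setUC.
  split=> //; first exact: (bs_compl reduced_splits).
  - by rewrite disjoints1 !inE eqxx.
  - by rewrite setD1K ?eqxx // !inE ab.
  - by rewrite /f' /= glueD ?sub1set ?inE ?ab ?aY // ga fab.
have [sepA|] := boolP ((a \in A) != (b \in A)); first by rewrite cord_sep.
have [sepB|] := boolP ((a \in B) != (b \in B)); first by rewrite setUC cord_sep.
rewrite !negbK => /eqP eB /eqP eA.
have sA := bs_sub bsC hA; have sB := bs_sub bsC hB.
apply/cordsP; exists (A :\ b), (B :\ b); rewrite /f' /= !inE !glueE // !setSD //; split=> //.
  by apply: disjointWl (subsetDl _ _) _; apply: disjointWr (subsetDl _ _) _.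
have sAB : A :|: B \subset Y by rewrite subUset sA.
rewrite -setDUl glueD ?setSD // glueE // ?subsetDl; last by rewrite !inE eA eB.
by case/orP: cov => [/eqP->|->]; rewrite ?eqxx ?orbT.
Qed.

End Reduction.
End SplitSystems.

Section Shelling.
Variable X : finType.
Implicit Types (Y A B D E : {set X}) (C : {set {set X}}) (f : {set X} -> X).

Lemma bs_reduce Y C f : binary_splits Y C -> stable_on C f -> 2 < #|Y| ->
  exists a b c C' f', [/\ [/\ a != b, c != a & c != b], [/\ a \in Y, b \in Y & c \in Y],
    [/\ [set a; b] \in C, #|C'| + 4 <= #|C| & forall A, A \in C' ->
      exists2 B, B \in C & forall z, z \in Y :\ b -> (z \in B) = (z \in A)],
    binary_splits (Y :\ b) C' /\ stable_on C' f' &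
    cords Y C f = [set a; b] |: ([set b; c] |: cords (Y :\ b) C' f')].
Proof.
move=> bsC stf Y3; have [a [b [ab aY bY abC fab]]] := bs_cherry bsC stf Y3.
have [cY ca cb] := c_mem bsC stf abC.
exists a, b, (f (Y :\: [set a; b])).
exists [set A : {set X} | (A \subset Y :\ b) && (glue a b A \in C)].
exists (fun A => f (glue a b A)); split=> //.
- split=> //; last exact: reduced_lift.
  by apply: (reduced_card bsC stf).
- split; first exact: reduced_splits.
  exact: reduced_stable.
exact: reduced_cords.
Qed.

Lemma cords_cord Y C f c : binary_splits Y C -> stable_on C f ->
  c \in cords Y C f -> is_cord c && (c \subset Y).
Proof.
move=> bsC [fin _] /cordsP[A [B [hA hB dAB _ ->]]].
have fA := fin _ hA; have fB := fin _ hB.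
have ne : f A != f B by apply/eqP=> e; apply: (disjointF dAB fA); rewrite e.
by rewrite /is_cord cards2 ne subUset !sub1set (bs_inY bsC hA) // (bs_inY bsC hB).
Qed.

Lemma cords_cover Y C f x : binary_splits Y C -> stable_on C f -> x \in Y ->
  exists2 c, c \in cords Y C f & x \in c.
Proof.
move=> bsC [fin _] xY; have xC := bs_singl bsC xY.
exists [set f [set x]; f (Y :\ x)].
  apply/cordsP; exists [set x], (Y :\ x); rewrite xC (bs_compl bsC) //.
  by rewrite disjoints1 !inE eqxx setD1K // eqxx.
by have := fin _ xC; rewrite !inE => /eqP->; rewrite eqxx.
Qed.

Lemma cords_pair Y C f : binary_splits Y C -> stable_on C f -> #|Y| = 2 ->
  cords Y C f = [set Y].
Proof.
move=> bsC stf Y2; apply/setP=> c; rewrite in_set1; apply/idP/eqP => [cL|->].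
  have /andP[/eqP c2 sc] := cords_cord bsC stf cL.
  by apply/eqP; rewrite eqEcard sc Y2 c2.
move/eqP/cards2P: (Y2) => [x [y [xy eY]]].
have xY : x \in Y by rewrite eY !inE eqxx.
have [d dL xd] := cords_cover bsC stf xY.
have /andP[/eqP d2 sd] := cords_cord bsC stf dL.
have e : d = Y by apply/eqP; rewrite eqEcard sd Y2 d2.
by rewrite e in dL.
Qed.

Lemma bs_ind (P : {set X} -> {set {set X}} -> ({set X} -> X) -> Prop) :
  (forall Y C f, binary_splits Y C -> stable_on C f -> #|Y| = 2 -> P Y C f) ->
  (forall Y C f a b c C' f', binary_splits Y C -> stable_on C f -> 2 < #|Y| ->
    [/\ a != b, c != a & c != b] -> [/\ a \in Y, b \in Y & c \in Y] ->
    [set a; b] \in C -> #|C'| + 4 <= #|C| ->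
    (forall A, A \in C' ->
      exists2 B, B \in C & forall z, z \in Y :\ b -> (z \in B) = (z \in A)) ->
    binary_splits (Y :\ b) C' -> stable_on C' f' ->
    cords Y C f = [set a; b] |: ([set b; c] |: cords (Y :\ b) C' f') ->
    P (Y :\ b) C' f' -> P Y C f) ->
  forall Y C f, binary_splits Y C -> stable_on C f -> 1 < #|Y| -> P Y C f.
Proof.
move=> P2 PS Y; move: {2}(#|Y| - 2) (erefl (#|Y| - 2)) => n.
elim: n Y => [|n IHn] Y nY C f bsC stf Y1; first by apply: P2 => //; lia.
have Y3 : 2 < #|Y| by lia.
have [a [b [c [C' [f' [abc abcY [abC cC lC] [bs' st'] eL]]]]]] := bs_reduce bsC stf Y3.
have bY : b \in Y by case: abcY.
have cYb : #|Y :\ b| = #|Y|.-1 by rewrite cardsDS ?sub1set // cards1; lia.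
by apply: (PS Y C f a b c C' f') => //; apply: IHn => //; rewrite cYb; lia.
Qed.

Lemma notin_cords Y C f b (s : {set X}) : binary_splits (Y :\ b) C -> stable_on C f ->
  b \in s -> s \notin cords (Y :\ b) C f.
Proof.
move=> bs' st' bs; apply/negP=> /(cords_cord bs' st')/andP[_ /subsetP/(_ _ bs)].
by rewrite !inE eqxx.
Qed.

Lemma card_cords Y C f : binary_splits Y C -> stable_on C f -> 1 < #|Y| ->
  #|cords Y C f| = 2 * #|Y| - 3.
Proof.
move: Y C f; apply: bs_ind => [Y C f bsC stf Y2|]; first by rewrite cords_pair // Y2 cards1.
move=> Y C f a b c C' f' bsC stf Y3 [ab ca cb] [aY bY cY] _ _ _ bs' st' -> IH.
have cYb : #|Y :\ b| = #|Y|.-1 by rewrite cardsDS ?sub1set // cards1; lia.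
have nb (s : {set X}) : b \in s -> s \notin cords (Y :\ b) C' f' by apply: notin_cords.
rewrite !cardsU1 IH cYb !in_setU1 !(negbTE (nb _ _)) ?inE ?eqxx ?orbT //.
rewrite (_ : (_ == _) = false); first by rewrite /=; lia.
by apply/negP=> /eqP/setP/(_ a); rewrite !inE eqxx (negbTE ab) eq_sym (negbTE ca).
Qed.

Lemma card_clusters Y C f : binary_splits Y C -> stable_on C f -> 1 < #|Y| ->
  4 * #|Y| - 6 <= #|C|.
Proof.
move: Y C f; apply: bs_ind => [Y C f bsC stf Y2|].
  move/eqP/cards2P: (Y2) => [x [y [xy eY]]].
  have xY : x \in Y by rewrite eY !inE eqxx.
  have yY : y \in Y by rewrite eY !inE eqxx orbT.
  have : [set [set x]; [set y]] \subset C by rewrite subUset !sub1set !(bs_singl bsC).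
  by move/subset_leq_card; rewrite cards2 (inj_eq set1_inj) xy Y2.
move=> Y C f a b c C' f' bsC stf Y3 [ab ca cb] [aY bY cY] _ cC _ bs' st' _ IH.
have cYb : #|Y :\ b| = #|Y|.-1 by rewrite cardsDS ?sub1set // cards1; lia.
rewrite cYb in IH; lia.
Qed.

Lemma new_cord Y C f a b c y : binary_splits (Y :\ b) C -> stable_on C f ->
  y != b ->
  ([set y; b] \in [set a; b] |: ([set b; c] |: cords (Y :\ b) C f)) = pred2 a c y.
Proof.
move=> bs' st' yb; rewrite !in_setU1.
rewrite (negbTE (notin_cords bs' st' _)) ?inE ?eqxx ?orbT // orbF; congr (_ || _).
  apply/eqP/eqP=> [/setP/(_ y)|->//]; rewrite !inE eqxx (negbTE yb) !orbF.
  by move/esym/eqP.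
apply/eqP/eqP=> [/setP/(_ y)|->]; last by rewrite setUC.
by rewrite !inE eqxx (negbTE yb) => /esym/eqP.
Qed.

Lemma cords_twod_tree Y C f : binary_splits Y C -> stable_on C f -> 1 < #|Y| ->
  exists (x1 x2 : X) (s' : seq X),
    let s := [:: x1, x2 & s'] in
    [/\ uniq s, s =i Y, [set x1; x2] \in cords Y C f &
        forall i, 2 <= i < size s ->
          count (fun y => [set y; nth x1 s i] \in cords Y C f) (take i s) = 2].
Proof.
move: Y C f; apply: bs_ind => [Y C f bsC stf Y2|].
  move/eqP/cards2P: (Y2) => [x [y [xy eY]]]; exists x, y, [::]; split.
  - by rewrite /= inE xy.
  - by move=> z; rewrite eY !inE.
  - by rewrite cords_pair // eY inE.
  - by move=> i /=; lia.
move=> Y C f a b c C' f' bsC stf Y3 [ab ca cb] [aY bY cY] _ _ _ bs' st' eL.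
case=> x1 [x2 [s' []]]; set s := [:: x1, x2 & s'] => us sY x12 cnt.
have bs : b \notin s by rewrite sY !inE eqxx.
have old y z : y \in s -> z \in s ->
    ([set y; z] \in cords Y C f) = ([set y; z] \in cords (Y :\ b) C' f').
  move=> ys zs; rewrite eL !in_setU1.
  have nE (t : {set X}) : b \in t -> ([set y; z] == t) = false.
    move=> bt; apply/negP=> /eqP/setP/(_ b); rewrite bt !inE => /orP[]/eqP e.
      by rewrite -e (negbTE bs) in ys.
    by rewrite -e (negbTE bs) in zs.
  by rewrite !nE // !inE eqxx ?orbT.
exists x1, x2, (s' ++ [:: b]); cbv zeta; rewrite -!cat_cons -/s; split.
- by rewrite cat_uniq us /= orbF bs.
- move=> z; rewrite mem_cat sY !inE; case: eqVneq => [->|_] //; by rewrite orbF.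
- by rewrite old // !inE eqxx ?orbT.
move=> i /andP[i2]; rewrite size_cat addn1 ltnS leq_eqVlt => /orP[/eqP->|lti].
  rewrite take_size_cat // nth_cat ltnn subnn [nth _ [:: b] 0]/= eL.
  rewrite (@eq_in_count _ _ (pred2 a c)); last first.
    by move=> y ys; rewrite new_cord //; apply: contraNneq bs => <-; exact: ys.
  have := count_predUI (pred1 a) (pred1 c) s.
  rewrite (@eq_count _ (predU _ _) (pred2 a c)) // (@eq_count _ (predI _ _) pred0).
    by rewrite count_pred0 addn0 !count_uniq_mem // !sY !inE ab cb aY cY.
  by move=> z /=; case: eqVneq => // ->; rewrite eq_sym (negbTE ca).
rewrite nth_cat lti take_cat lti -(cnt i) ?i2 //.
apply: eq_in_count => y /mem_take ys; rewrite old // ?mem_nth //.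
Qed.

Lemma cords_shelling Y C f : binary_splits Y C -> stable_on C f -> 1 < #|Y| ->
  exists ms : seq {set X},
    [/\ uniq ms,
        forall c, (c \in ms) = [&& is_cord c, c \subset Y & c \notin cords Y C f] &
        forall mu, mu < size ms -> exists a b x y,
          [/\ nth set0 ms mu = [set a; b], uniq [:: a; b; x; y] &
            [/\ [set a; b; x; y] \subset Y,
              exists2 A, A \in C & [&& a \in A, x \in A, y \notin A & b \notin A] &
              forall c, is_cord c -> c \subset [set a; b; x; y] -> c != [set a; b] ->
                (c \in cords Y C f) || (c \in take mu ms)]]].
Proof.
move: Y C f; apply: bs_ind => [Y C f bsC stf Y2|].
  exists [::]; split=> // c; rewrite cords_pair // inE in_nil; apply/esym/negP.
  by case/and3P=> /eqP c2 sc; rewrite eqEcard sc Y2 c2.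
move=> Y C f a b c C' f' bsC stf Y3 [ab ca cb] [aY bY cY] abC _ lC bs' st' eL.
case=> ms [ums mem_ms sh].
pose Z := Y :\: [set a; b; c].
have bn (s : {set X}) : b \in s -> s \notin ms.
  by move=> bs; rewrite mem_ms; apply/negP=> /and3P[_ /subsetP/(_ _ bs)]; rewrite !inE eqxx.
have ZP z : z \in Z -> [/\ z \in Y, z != a, z != b & z != c].
  by rewrite !inE !negb_or -!andbA => /and4P[].
have cord_bP (s : {set X}) : is_cord s -> s \subset Y -> b \in s ->
    exists2 z, s = [set z; b] & z != b /\ z \in Y.
  move=> /cards2P[p [q [pq ->]]]; rewrite subUset !sub1set !inE => /andP[pY qY].
  case/orP=> /eqP e; [exists q; last by rewrite e eq_sym | exists p; last by rewrite e].
    by rewrite setUC e.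
  by rewrite e.
have oldL (s : {set X}) : b \notin s -> (s \in cords Y C f) = (s \in cords (Y :\ b) C' f').
  move=> bs; rewrite eL !in_setU1.
  have nE (t : {set X}) : b \in t -> (s == t) = false by move=> bt; apply: contraNF bs => /eqP->.
  by rewrite !nE // !inE eqxx ?orbT.
have oldY (s : {set X}) : b \notin s -> (s \subset Y :\ b) = (s \subset Y).
  by move=> bs; rewrite subsetD1 bs andbT.
have old (s : {set X}) : is_cord s -> s \subset Y :\ b -> (s \in cords Y C f) || (s \in ms).
  move=> cs ss; rewrite mem_ms cs ss /= oldL ?orbN //.
  by apply/negP=> /(subsetP ss); rewrite !inE eqxx.
have inew z : z != b -> ([set z; b] \in cords Y C f) = pred2 a c z.
  by move=> zb; rewrite eL new_cord.
exists (ms ++ [seq [set z; b] | z <- enum Z]); split.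
- rewrite cat_uniq ums /=; apply/andP; split.
    apply/hasPn=> _ /mapP[z _ ->]; apply: bn; by rewrite !inE eqxx orbT.
  rewrite map_inj_in_uniq ?enum_uniq // => z t; rewrite !mem_enum.
  move=> /ZP[_ _ zb _] /ZP[_ _ tb _] /setP/(_ z).
  by rewrite !inE eqxx (negbTE zb) !orbF => /esym/eqP.
- move=> s; rewrite mem_cat; have [bs|bs] := boolP (b \in s); last first.
    rewrite mem_ms oldY // oldL // orbC; case: mapP => // [[z _ e]].
    by rewrite e !inE eqxx orbT in bs.
  rewrite (negbTE (bn _ bs)) /=; apply/mapP/and3P.
    case=> z; rewrite mem_enum => /ZP[zY za zb zc] ->.
    rewrite inew //= (negbTE za) (negbTE zc) subUset !sub1set zY bY.
    by rewrite /is_cord cards2 zb.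
  case=> cs sY; have [z -> [zb zY]] := cord_bP s cs sY bs.
  rewrite inew //= => zac; exists z => //; rewrite mem_enum !inE zY andbT.
  by move: zac; rewrite !negb_or zb => /andP[-> ->].
move=> mu; rewrite size_cat => ltmu; have [lt|ge] := ltnP mu (size ms).
  have [p [q [x [y [emu u [sY [A AC' hA] hc]]]]]] := sh _ lt.
  exists p, q, x, y; rewrite nth_cat lt; split=> //.
  have sYY : [set p; q; x; y] \subset Y by apply: subset_trans sY (subsetDl _ _).
  split=> //.
    have [B BC eB] := lC _ AC'; exists B => //.
    by rewrite !eB //; apply: (subsetP sY); rewrite !inE eqxx ?orbT.
  move=> s cs ss sn; rewrite take_cat lt oldL ?hc //.
  by apply/negP=> /(subsetP ss)/(subsetP sY); rewrite !inE eqxx.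
rewrite nth_cat ltnNge ge /=.
have : nth set0 [seq [set z; b] | z <- enum Z] (mu - size ms) \in [seq [set z; b] | z <- enum Z].
  by apply: mem_nth; rewrite -(ltn_add2l (size ms)) subnKC.
case/mapP=> z; rewrite mem_enum => /ZP[zY za zb zc] ->.
exists b, z, a, c; split; first by rewrite setUC.
  by rewrite /= !inE !negb_or !(eq_sym b) (eq_sym a c) zb ab cb za zc ca.
split.
- by rewrite !subUset !sub1set aY bY cY zY.
- by exists [set a; b] => //; rewrite !inE !eqxx (negbTE ca) (negbTE cb) (negbTE za) (negbTE zb) orbT.
move=> s cs ss sn; rewrite take_cat ltnNge ge /= mem_cat.
have sY : s \subset Y.
  by apply: subset_trans ss _; rewrite !subUset !sub1set aY bY cY zY.
have [bs|bs] := boolP (b \in s); last first.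
  by rewrite orbA old // oldY.
have [t es [tb tY]] := cord_bP s cs sY bs; rewrite es inew //.
have := subsetP ss t; rewrite es !inE eqxx /= (negbTE tb) => /(_ isT) /=.
case/orP=> [/orP[/eqP tz|->]|->]; rewrite ?orbT //.
by move: sn; rewrite es tz setUC eqxx.
Qed.

End Shelling.

(** * Clusters of a tree *)

Lemma connect_closed (V : finType) (e : rel V) (P : pred V) x y :
  (forall a b, e a b -> P a -> P b) -> connect e x y -> P x -> P y.
Proof.
move=> cl /connectP[p]; elim: p x => [|z p IH] x /=; first by move=> _ ->.
by move=> /andP[xz zp] ey Px; apply: (IH z zp ey); apply: cl xz Px.
Qed.

Section TreeClusters.
Variables (X : finType) (T : Xtree X).
Hypothesis hT : is_Xtree T.
Implicit Types (u v x y z t : vt T).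

Definition branch u v : {set vt T} := [set z | connect (rm_edge u v) v z].

Lemma adj_sym u v : adj T u v = adj T v u.
Proof. by case: hT => [[sT _ _] _]; apply: sT. Qed.

Lemma adj_irr u : adj T u u = false.
Proof. by case: hT => [[_ iT _] _]; apply: iT. Qed.

Lemma adj_neq u v : adj T u v -> u != v.
Proof. by move=> auv; apply: contraTneq auv => ->; rewrite adj_irr. Qed.

Lemma adj_connect u v : connect (adj T) u v.
Proof. by case: hT => [[_ _ cT] _]; apply: cT. Qed.

Lemma leafK : injective (leaf T).
Proof. by case: hT => [_ []]. Qed.

Lemma leaf_vertexE v : is_leaf_vertex v = (deg v <= 1).
Proof. by case: hT => [_ []]. Qed.

Lemma leaf_vertexP v : reflect (exists l, leaf T l = v) (is_leaf_vertex v).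
Proof.
by apply: (iffP existsP) => [[x /eqP]|[x e]]; exists x => //; apply/eqP.
Qed.

Lemma in_side u v l : (l \in side u v) = (leaf T l \in branch u v).
Proof. by rewrite !inE. Qed.

Lemma branch_refl u v : v \in branch u v.
Proof. by rewrite inE connect0. Qed.

Lemma branch_step u v x y : adj T x y -> x \in branch u v -> y \notin branch u v ->
  x = v /\ y = u.
Proof.
move=> axy; rewrite !inE => cx cy.
have : ~~ rm_edge u v x y by apply: contra cy => exy; apply: connect_trans cx (connect1 exy).
rewrite /rm_edge /= axy /= negbK => /orP[]/andP[/eqP ex /eqP ey] //.
by rewrite ey connect0 in cy.
Qed.

Lemma rm_edge_sym u v : symmetric (rm_edge u v).
Proof.
by move=> x y; rewrite /rm_edge /= adj_sym; congr (_ && ~~ _); rewrite orbC ![(y == _) && _]andbC.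
Qed.

Lemma rm_edgeC u v : rm_edge u v =2 rm_edge v u.
Proof. by move=> x y; rewrite /rm_edge /= orbC. Qed.

Lemma branch_notin u v : adj T u v -> u \notin branch u v.
Proof.
move=> auv; apply/negP; rewrite inE => /connectP[p0 pp0 eu].
case/shortenP: pp0 eu => p pp up _ eu.
case: hT => [_ [acyc _ _ _]]; have := acyc (v :: p) up.
case: p pp up eu => [|x [|y p]] pp up eu.
- by move: (adj_neq auv); rewrite eu eqxx.
- by move: pp eu; rewrite /= /rm_edge /= => + eu; rewrite -eu !eqxx /= orbT andbF.
move=> /(_ isT)/negP; apply; rewrite /cycle rcons_path -eu auv andbT.
by apply: sub_path pp => s t /andP[].
Qed.

Lemma branchC u v : adj T u v -> branch v u = ~: branch u v.
Proof.
move=> auv; apply/setP=> z; rewrite [RHS]inE; apply/idP/idP=> [|zn].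
  rewrite inE (eq_connect (rm_edgeC v u)) => uz; apply/negP=> vz.
  have /negP := branch_notin auv; apply; rewrite inE.
  rewrite inE in vz; apply: connect_trans vz _.
  by rewrite (sym_connect_sym (@rm_edge_sym u v)).
suff : z \in branch v u :|: branch u v by rewrite inE (negbTE zn) orbF.
pose P z := z \in branch v u :|: branch u v.
apply: (connect_closed (P := P) _ (adj_connect u z)); last by rewrite /P inE branch_refl.
rewrite /P => a b aab aC; apply/negPn/negP; rewrite inE negb_or => /andP[b1 b2].
move: aC; rewrite inE => /orP[] aC.
  by have [_ eb] := branch_step aab aC b1; rewrite eb branch_refl in b2.
by have [_ eb] := branch_step aab aC b2; rewrite eb branch_refl in b1.
Qed.

Lemma branch_same u v x y : adj T u v -> adj T x y ->
  (x \in branch u v) != (y \in branch u v) -> (x, y) = (u, v) \/ (x, y) = (v, u).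
Proof.
move=> auv axy; have [xC|xC] := boolP (x \in branch u v) => /=.
  by case: (boolP (y \in _)) => // yC _; have [-> ->] := branch_step axy xC yC; right.
case: (boolP (y \in _)) => // yC _; rewrite adj_sym in axy.
by have [-> ->] := branch_step axy yC xC; left.
Qed.

Lemma branch_sub u v x y z : adj T x y -> x \notin branch u v ->
  y \notin branch u v -> z \in branch u v -> z \in branch x y -> branch u v \subset branch x y.
Proof.
move=> axy xn yn zu zx.
have key t : t \in branch u v -> (t \in branch x y) = (v \in branch x y).
  move=> tC; pose P := [pred t | (t \in branch u v) && ((t \in branch x y) == (v \in branch x y))].
  suff /andP[_ /eqP] : P t by [].
  move: (tC); rewrite inE => ct; apply: (connect_closed (P := P) _ ct); last by rewrite /= branch_refl eqxx.
  move=> a b eab /andP[aC /eqP ea]; have aab : adj T a b by case/andP: eab.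
  have bC : b \in branch u v by move: aC; rewrite !inE => /connect_trans; apply; apply: connect1.
  rewrite /= bC -ea; apply/negPn/negP; rewrite eq_sym => /(branch_same axy aab)[]; case=> e1 e2.
    by rewrite -e1 aC in xn.
  by rewrite -e1 aC in yn.
by apply/subsetP=> t /key->; rewrite -(key z).
Qed.

Lemma branch_nest u v x y : adj T u v -> adj T x y ->
  [\/ branch u v \subset branch x y, branch x y \subset branch u v,
      [disjoint branch u v & branch x y] | branch u v :|: branch x y = setT].
Proof.
move=> auv axy; have avu : adj T v u by rewrite adj_sym.
case: (eqVneq (x \in branch u v) (y \in branch u v)) => [exy|]; last first.
  case/(branch_same auv axy)=> [[-> ->]|[-> ->]]; first by constructor 1.
  by constructor 4; rewrite (branchC auv) setUCr.
have [xC|xC] := boolP (x \in branch u v); last first.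
  have [d|/pred0Pn[z /andP[z1 z2]]] := boolP [disjoint branch u v & branch x y].
    by constructor 3.
  by constructor 1; apply: (branch_sub axy xC _ z1 z2); rewrite -exy.
have xC' : x \notin branch v u by rewrite branchC // inE negbK.
have yC' : y \notin branch v u by rewrite branchC // inE negbK -exy.
have [d|/pred0Pn[z /andP[z1 z2]]] := boolP [disjoint branch v u & branch x y].
  by constructor 2; move: d; rewrite disjoint_sym disjoints_subset (branchC auv) setCK.
constructor 4; have := branch_sub axy xC' yC' z1 z2; rewrite (branchC auv) => s.
apply/setP=> t; rewrite in_setU in_setT; have := subsetP s t; rewrite in_setC.
by case: (t \in branch u v) => //= ->.
Qed.

Lemma path_branch v z p : path (adj T) z p -> v \notin z :: p ->
  last z p \in branch v z.
Proof.
move=> pp vn; rewrite inE; apply/connectP; exists p => //.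
have : forall y, path (rm_edge v y) z p; last by apply.
elim: p z pp vn => //= a p IH z /andP[aza pa]; rewrite !inE !negb_or.
move=> /and3P[vz va vp] y; rewrite {1}/rm_edge /= aza IH ?inE ?negb_or ?va ?vp // andbT.
by rewrite !negb_and [z == v]eq_sym vz [a == v]eq_sym va orbT.
Qed.

Lemma exists_nbr v t : t != v -> exists2 z, adj T v z & t \in branch v z.
Proof.
move=> tv; case/connectP: (adj_connect v t) => p0 pp0 et.
case/shortenP: pp0 et => -[|z p] pp up _ et; first by rewrite et eqxx in tv.
move: pp up => /= /andP[avz pz] /andP[vn _]; exists z => //.
by rewrite et; apply: path_branch.
Qed.

Lemma branch_sub_nbr u v z : adj T u v -> adj T v z -> z != u -> branch v z \subset branch u v.
Proof.
move=> auv avz zu; have vn := branch_notin avz.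
have un : u \notin branch v z.
  by apply/negP=> uC; have [e _] := branch_step auv uC vn; rewrite e eqxx in zu.
apply: (branch_sub auv un vn (branch_refl v z)); apply/negPn/negP=> zn.
by have [_ e] := branch_step avz (branch_refl u v) zn; rewrite e eqxx in zu.
Qed.

Lemma branch_split u v t : adj T u v -> t \in branch u v -> t != v ->
  exists z, [/\ adj T v z, z != u & t \in branch v z].
Proof.
move=> auv tC tv; have [z avz tz] := exists_nbr tv; exists z; split=> //.
by apply: contraTneq tz => ->; rewrite branchC // inE negbK.
Qed.

Lemma branch_disjoint v z1 z2 : adj T v z1 -> adj T v z2 -> z1 != z2 ->
  [disjoint branch v z1 & branch v z2].
Proof.
move=> a1 a2 z12; rewrite disjoints_subset -branchC //.
by apply: branch_sub_nbr => //; rewrite adj_sym.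
Qed.

Lemma branch_sub_of_notin v z p q t : adj T v z -> v \notin branch p q ->
  t \in branch p q -> t \in branch v z -> branch p q \subset branch v z.
Proof.
move=> avz vn tp tv; have [zC|zC] := boolP (z \in branch p q); last first.
  exact: branch_sub tp tv.
by rewrite adj_sym in avz; have [-> ->] := branch_step avz zC vn.
Qed.

Lemma leaf_nbr v u z : is_leaf_vertex v -> adj T v u -> adj T v z -> z = u.
Proof.
rewrite leaf_vertexE => /card_le1_eqP le1 au az; apply: le1; by rewrite inE.
Qed.

Lemma interior_deg v : ~~ is_leaf_vertex v -> 2 < deg v.
Proof.
rewrite leaf_vertexE => d1; case: hT => [_ [_ _ _ /(_ v)]]; lia.
Qed.

Lemma interior_nbrs v u : ~~ is_leaf_vertex v -> exists z1 z2,
  [/\ adj T v z1, adj T v z2, z1 != z2, z1 != u & z2 != u].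
Proof.
move=> /interior_deg d3; have : 1 < #|[set z | adj T v z] :\ u|.
  by move: d3; rewrite /deg (cardsD1 u); case: (_ \in _); lia.
case/card_gt1P=> z1 [z2 []]; rewrite !inE => /andP[n1 a1] /andP[n2 a2] n12.
by exists z1, z2.
Qed.

Lemma side_neq0 u v : adj T u v -> exists l, leaf T l \in branch u v.
Proof.
have [n] := ubnP #|branch u v|; elim: n u v => // n IH u v ltn auv.
have [/leaf_vertexP[l el]|nl] := boolP (is_leaf_vertex v).
  by exists l; rewrite el branch_refl.
have [z [_ [avz _ _ zu _]]] := interior_nbrs u nl.
have s := branch_sub_nbr auv avz zu.
have [|l ls] := IH v z _ avz; last by exists l; apply: (subsetP s).
rewrite -ltnS; apply: leq_trans ltn; rewrite ltnS; apply: proper_card.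
by apply/properP; split=> //; exists v; [apply: branch_refl | apply: branch_notin].
Qed.

Lemma leaf_branch u v : is_leaf_vertex v -> adj T u v -> branch u v = [set v].
Proof.
move=> lv auv; apply/setP=> t; rewrite [RHS]inE; apply/idP/eqP=> [tC|->]; last exact: branch_refl.
apply/eqP/negPn/negP=> tv; have [z [avz zu _]] := branch_split auv tC tv.
by rewrite adj_sym in auv; rewrite (leaf_nbr lv auv avz) eqxx in zu.
Qed.

Lemma side_leaf u l : adj T u (leaf T l) -> side u (leaf T l) = [set l].
Proof.
move=> au; apply/setP=> k; rewrite in_side leaf_branch // ?inE ?(inj_eq leafK) //.
by apply/leaf_vertexP; exists l.
Qed.

Lemma sideC u v : adj T u v -> side v u = ~: side u v.
Proof. by move=> auv; apply/setP=> l; rewrite in_setC !in_side branchC // inE. Qed.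

Lemma branch_proper_side u v x y : adj T u v -> adj T x y -> (u, v) != (x, y) ->
  branch u v \subset branch x y -> exists2 l, l \in side x y & l \notin side u v.
Proof.
move=> auv axy ne s.
have vxy : v \in branch x y by apply: (subsetP s); apply: branch_refl.
have uxy : u \in branch x y.
  apply/negPn/negP=> un; rewrite adj_sym in auv.
  by have [e1 e2] := branch_step auv vxy un; rewrite e1 e2 eqxx in ne.
have xu : x \in branch v u.
  by rewrite branchC // inE; apply: contra (branch_notin axy) => /(subsetP s).
have nl : ~~ is_leaf_vertex u.
  apply/negP=> lu; move: xu; rewrite leaf_branch 1?adj_sym // inE => /eqP ex.
  by have := branch_notin axy; rewrite {1}ex uxy.
have [z1 [z2 [a1 a2 z12 z1v z2v]]] := interior_nbrs v nl.
have [z [az zv xz]] : exists z, [/\ adj T u z, z != v & x \notin branch u z].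
  have [x1|x1] := boolP (x \in branch u z1); last by exists z1.
  by exists z2; split=> //; apply/negP; apply: disjointF (branch_disjoint a1 a2 z12) x1.
have yz : y \notin branch u z.
  apply/negP=> yz; rewrite adj_sym in axy; have [_ e] := branch_step axy yz xz.
  by rewrite adj_sym in axy; have := branch_notin axy; rewrite {1}e uxy.
have zxy : z \in branch x y.
  apply/negPn/negP=> zn; have [_ e] := branch_step az uxy zn.
  by rewrite -e branch_refl in xz.
have sz := branch_sub axy xz yz (branch_refl u z) zxy.
have [l lz] := side_neq0 az; exists l; rewrite in_side; first exact: (subsetP sz).
apply/negP; exact: disjointF (branch_disjoint az auv zv) lz.
Qed.

Lemma side_inj u v x y : adj T u v -> adj T x y -> side u v = side x y -> (u, v) = (x, y).
Proof.
move=> auv axy es; apply/eqP/negPn/negP=> ne.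
case: (branch_nest auv axy) => [s|s|d|e].
- by have [l] := branch_proper_side auv axy ne s; rewrite es => ->.
- by rewrite eq_sym in ne; have [l] := branch_proper_side axy auv ne s; rewrite es => ->.
- have [l l1] := side_neq0 auv; apply: (disjointF d l1).
  by rewrite -in_side -es in_side.
- have avu : adj T v u by rewrite adj_sym.
  have [l] := side_neq0 avu; rewrite branchC // inE => ln.
  have : leaf T l \in branch u v :|: branch x y by rewrite e inE.
  by rewrite inE (negbTE ln) -in_side -es in_side (negbTE ln).
Qed.

Lemma clusP A : reflect (exists u v, adj T u v /\ A = side u v) (A \in clus T).
Proof.
rewrite inE; apply: (iffP existsP) => [[u /existsP[v /andP[a /eqP e]]]|[u [v [a e]]]].
  by exists u, v.
by exists u; apply/existsP; exists v; rewrite a e eqxx.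
Qed.

Lemma clus_side u v : adj T u v -> side u v \in clus T.
Proof. by move=> a; apply/clusP; exists u, v. Qed.

Lemma side_compatible u v x y : adj T u v -> adj T x y ->
  compatible setT (side u v) (side x y).
Proof.
move=> auv axy; apply/or4P; case: (branch_nest auv axy) => [s|s|d|e].
- by constructor 1; apply/subsetP=> l; rewrite !in_side; apply: (subsetP s).
- by constructor 2; apply/subsetP=> l; rewrite !in_side; apply: (subsetP s).
- constructor 3; rewrite disjoint_subset; apply/subsetP=> l.
  rewrite in_side => l1; rewrite inE in_side; apply/negP; exact: disjointF d l1.
- constructor 4; apply/subsetP=> l _; rewrite in_setU !in_side -in_setU e inE //.
Qed.

Lemma side_card u v : adj T u v -> 1 < #|side u v| -> ~~ is_leaf_vertex v.
Proof.
by move=> auv; apply: contraTN => /leaf_vertexP[l el]; rewrite -el side_leaf ?cards1 ?el.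
Qed.

Lemma leaf_adj l : 1 < #|X| -> exists u, adj T u (leaf T l).
Proof.
move=> /card_gt1P[k1 [k2 [_ _ k12]]].
have [k kl] : exists k, k != l.
  by have [e|] := eqVneq k1 l; [exists k2; rewrite -e eq_sym | exists k1].
have : leaf T k != leaf T l by rewrite (inj_eq leafK).
by case/exists_nbr=> u a _; exists u; rewrite adj_sym.
Qed.

Lemma resolved_nbrs u v : fully_resolved T -> adj T u v -> ~~ is_leaf_vertex v ->
  exists z1 z2, [/\ adj T v z1, adj T v z2, z1 != z2, z1 != u /\ z2 != u &
    forall z, adj T v z -> [|| z == u, z == z1 | z == z2]].
Proof.
move=> fr auv nl; have [z1 [z2 [a1 a2 z12 n1 n2]]] := interior_nbrs u nl.
exists z1, z2; split=> // z az; apply/negPn/negP; rewrite !negb_or => /and3P[zu zz1 zz2].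
have := fr v nl; rewrite /deg => d3.
have : [set u; z1; z2; z] \subset [set t | adj T v t].
  by rewrite !subUset !sub1set !inE a1 a2 az adj_sym auv.
move/subset_leq_card; rewrite d3 -!setUA !cardsU1 cards1 !inE !negb_or.
by rewrite z12 ![u == _]eq_sym ![_ == z]eq_sym n1 n2 zu zz1 zz2.
Qed.

Lemma resolved_split u v : fully_resolved T -> adj T u v -> 1 < #|side u v| ->
  exists z1 z2, [/\ adj T v z1, adj T v z2, z1 != z2, z1 != u /\ z2 != u &
    [/\ ~~ is_leaf_vertex v, side u v = side v z1 :|: side v z2 &
        [disjoint side v z1 & side v z2]]].
Proof.
move=> fr auv c1; have nl := side_card auv c1.
have [z1 [z2 [a1 a2 z12 [n1 n2] all]]] := resolved_nbrs fr auv nl.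
exists z1, z2; split=> //; split=> //.
  apply/setP=> l; rewrite in_setU !in_side; apply/idP/orP=> [lC|[]]; last 2 first.
  - exact: (subsetP (branch_sub_nbr auv a1 n1)).
  - exact: (subsetP (branch_sub_nbr auv a2 n2)).
  have lv : leaf T l != v by apply: contraNneq nl => <-; apply/leaf_vertexP; exists l.
  have [z [az zu lz]] := branch_split auv lC lv.
  by case/or3P: (all z az) => /eqP e; rewrite e ?eqxx // in zu lz; [left | right].
rewrite disjoint_subset; apply/subsetP=> l; rewrite in_side => l1; rewrite inE in_side.
apply/negP; exact: disjointF (branch_disjoint a1 a2 z12) l1.
Qed.

Lemma clus_neq0 A : A \in clus T -> A != set0.
Proof.
case/clusP=> u [v [a ->]]; have [l l1] := side_neq0 a.
by apply/set0Pn; exists l; rewrite in_side.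
Qed.

Lemma clusC A : A \in clus T -> ~: A \in clus T.
Proof.
by case/clusP=> u [v [a ->]]; rewrite -sideC // clus_side // adj_sym.
Qed.

Lemma clus1 l : 1 < #|X| -> [set l] \in clus T.
Proof. by case/(leaf_adj l)=> u a; rewrite -(side_leaf a) clus_side. Qed.

Lemma clus_compatible A B : A \in clus T -> B \in clus T -> compatible setT A B.
Proof.
by case/clusP=> u [v [a ->]] /clusP[x [y [b ->]]]; apply: side_compatible.
Qed.

Lemma clus_splits : 1 < #|X| -> fully_resolved T -> binary_splits setT (clus T).
Proof.
move=> X2 fr; split.
- by move=> A _; apply: subsetT.
- exact: clus_neq0.
- by move=> A; rewrite setTD; apply: clusC.
- by move=> l _; apply: clus1.
- exact: clus_compatible.
- move=> A /clusP[u [v [a ->]]] c1.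
  have [z1 [z2 [a1 a2 _ _ [_ e d]]]] := resolved_split fr a c1.
  by exists (side v z1), (side v z2); rewrite !clus_side.
Qed.

Lemma L_TfP f c : reflect (exists v u1 u2, [/\ ~~ is_leaf_vertex v, adj T v u1, adj T v u2,
     u1 != u2 & c = [set f (side v u1); f (side v u2)]]) (c \in L_Tf T f).
Proof.
rewrite inE; apply: (iffP existsP) => [[v /existsP[u1 /existsP[u2]]]|].
  by case/and5P=> n a1 a2 ne /eqP e; exists v, u1, u2.
case=> v [u1 [u2 [n a1 a2 ne ->]]]; exists v; apply/existsP; exists u1.
by apply/existsP; exists u2; rewrite n a1 a2 ne eqxx.
Qed.

Lemma L_Tf_cords f : 2 < #|X| -> fully_resolved T -> stable_transversal T f ->
  L_Tf T f = cords setT (clus T) f.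
Proof.
move=> X3 fr stf; have X2 : 1 < #|X| by apply: ltnW.
have bsC := clus_splits X2 fr.
apply/setP=> c; apply/L_TfP/cordsP.
  case=> v [u1 [u2 [nl a1 a2 ne ->]]]; have a1' : adj T u1 v by rewrite adj_sym.
  have [z1 [z2 [b1 b2 z12 [n1 n2] all]]] := resolved_nbrs fr a1' nl.
  exists (side v u1), (side v u2); rewrite !clus_side //; split=> //.
    rewrite disjoint_subset; apply/subsetP=> l; rewrite in_side => l1; rewrite inE in_side.
    apply/negP; exact: disjointF (branch_disjoint a1 a2 ne) l1.
  have [u3 a3 [n31 n32 all3]] : exists2 u3, adj T v u3 & [/\ u3 != u1, u3 != u2 &
      forall z, adj T v z -> [|| z == u1, z == u2 | z == u3]].
    have := all _ a2; rewrite eq_sym (negbTE ne) /= => /orP[]/eqP e.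
      by exists z2 => //; split=> //; [rewrite e eq_sym | move=> z /all; rewrite e].
    exists z1 => //; split=> //; first by rewrite e.
    by move=> z /all; rewrite e => /or3P[]->; rewrite ?orbT.
  apply/orP; right; rewrite (_ : _ :\: _ = side v u3) ?clus_side //.
  apply/setP=> l; rewrite in_setD in_setU in_setT andbT !in_side.
  have lv : leaf T l != v by apply: contraNneq nl => <-; apply/leaf_vertexP; exists l.
  have [z az lz] := exists_nbr lv.
  have dis p q : adj T v p -> adj T v q -> p != q -> leaf T l \in branch v p ->
      leaf T l \in branch v q = false.
    by move=> ap aq npq lp; apply/negP; exact: disjointF (branch_disjoint ap aq npq) lp.
  case/or3P: (all3 z az) => /eqP e; rewrite e in lz; rewrite lz /=.
  - by rewrite (dis u1) // eq_sym.
  - by rewrite orbT (dis u2) // eq_sym.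
  - by rewrite (dis u3 u1) // (dis u3 u2).
case: stf => fin fst [A [B [hA hB dAB cov ->]]].
have big E F : E \in clus T -> F \in clus T -> E :|: F = setT -> [disjoint E & F] ->
    1 < #|E| -> exists v u1 u2, [/\ ~~ is_leaf_vertex v, adj T v u1, adj T v u2,
      u1 != u2 & [set f E; f F] = [set f (side v u1); f (side v u2)]].
  move=> hE hF EF dEF c1; move/clusP: (hE) => [u [v [a eE]]]; rewrite eE in c1.
  have [z1 [z2 [a1 a2 z12 [n1 n2] [nl e d]]]] := resolved_split fr a c1.
  have eF : F = side v u.
    rewrite sideC // -eE; apply/setP=> l; rewrite inE; have : l \in E :|: F by rewrite EF.
    rewrite inE; case: (boolP (l \in E)) => //= lE _; apply/negP; exact: disjointF dEF lE.
  have avu : adj T v u by rewrite adj_sym.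
  have := fin _ hE; rewrite {2}eE e inE => /orP[] fE.
    exists v, z1, u; split=> //; rewrite -eF (fst E (side v z1)) ?clus_side //.
    by rewrite eE e subsetUl.
  exists v, z2, u; split=> //; rewrite -eF (fst E (side v z2)) ?clus_side //.
  by rewrite eE e subsetUr.
case/orP: cov => [/eqP AB|hD].
  have [A1|A1] := ltnP 1 #|A|; first exact: big.
  rewrite setUC; apply: big => //; [by rewrite setUC | by rewrite disjoint_sym |].
  have : #|A :|: B| = #|X| by rewrite AB cardsT.
  by rewrite cardsU (disjoint_setI0 dAB) cards0; lia.
move/clusP: hD => [z [v [a]]]; rewrite setTD => eD.
have avz : adj T v z by rewrite adj_sym.
have eAB : A :|: B = side v z by rewrite sideC // -eD setCK.
have [lA lA1] := set0Pn _ (clus_neq0 hA); have [lB lB1] := set0Pn _ (clus_neq0 hB).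
have lAB : lA != lB by apply/eqP=> e; apply: (disjointF dAB lA1); rewrite e.
have c1 : 1 < #|side v z|.
  by rewrite -eAB; apply/card_gt1P; exists lA, lB; rewrite !inE lA1 lB1 orbT.
have [z1 [z2 [a1 a2 z12 [n1 n2] [nl e d]]]] := resolved_split fr avz c1.
have pr : side z z1 :|: side z z2 \proper setT.
  rewrite -e properT; have [l l1] := side_neq0 a; apply/negP=> /eqP/setP/(_ l).
  by rewrite in_side (branchC a) in_setC l1 in_setT.
have sub E F : E \in clus T -> F \in clus T -> [disjoint E & F] -> E :|: F = side v z ->
    E \subset side z z1 \/ E \subset side z z2.
  move=> hE hF dEF EF; apply: (bs_split_compat bsC) => //; rewrite ?clus_side //.
    by rewrite -e -EF subsetUl.
  rewrite -e -EF; apply/eqP=> /setP eE; have [l lF] := set0Pn _ (clus_neq0 hF).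
  by apply: (disjointF dEF _ lF); rewrite eE inE lF orbT.
have eqE E F p q : E :|: F = side z p :|: side z q -> [disjoint side z p & side z q] ->
    E \subset side z p -> F \subset side z q -> E = side z p /\ F = side z q.
  move=> EF dpq sE sF; split; apply/eqP; rewrite eqEsubset ?sE ?sF; apply/subsetP=> l l1.
    have : l \in E :|: F by rewrite EF inE l1.
    by rewrite inE => /orP[] // /(subsetP sF)/(disjointF dpq l1).
  have : l \in E :|: F by rewrite EF inE l1 orbT.
  by rewrite inE => /orP[] // /(subsetP sE) l2; case: (disjointF dpq l2 l1).
have BA : B :|: A = side v z by rewrite setUC.
have dBA : [disjoint B & A] by rewrite disjoint_sym.
have bad p q : side v z = side z p :|: side z q -> [disjoint side z p & side z q] ->
    adj T z q -> A \subset side z p -> B \subset side z p -> False.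
  move=> epq dpq aq sA sB; have [l l1] := side_neq0 aq; rewrite -in_side in l1.
  have : l \in A :|: B by rewrite eAB epq inE l1 orbT.
  by rewrite inE => /orP[/(subsetP sA)|/(subsetP sB)] l2; apply: (disjointF dpq l2 l1).
have d' : [disjoint side z z2 & side z z1] by rewrite disjoint_sym.
case: (sub _ _ hA hB dAB eAB) (sub _ _ hB hA dBA BA) => sA [] sB.
- by case: (bad z1 z2).
- have [-> ->] := eqE A B z1 z2 (etrans eAB e) d sA sB; by exists z, z1, z2.
- have [-> ->] := eqE B A z1 z2 (etrans BA e) d sB sA; by exists z, z2, z1; rewrite eq_sym.
- by case: (bad z2 z1) => //; rewrite e setUC.
Qed.

End TreeClusters.

(** * Distances *)

Section Distances.
Variables (X : finType) (R : realType) (T : Xtree X).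
Hypothesis hT : is_Xtree T.
Implicit Types (w : weighting R T) (u v : vt T) (k l : X).
Local Open Scope ring_scope.

Definition dist2 w k l : R :=
  \sum_(e : vt T * vt T | adj T e.1 e.2)
     w [set e.1; e.2] * ((k \in side e.1 e.2) (+) (l \in side e.1 e.2))%:R.

Lemma dist2C w k l : dist2 w k l = dist2 w l k.
Proof. by apply: eq_bigr => e _; rewrite addbC. Qed.

Lemma dist2_refl w k : dist2 w k k = 0.
Proof. by rewrite /dist2 big1 // => e _; rewrite addbb mulr0. Qed.

Lemma sum_edge w u v : adj T u v ->
  \sum_(e : vt T * vt T | adj T e.1 e.2) w [set e.1; e.2] * (e == (u, v))%:R =
  w [set u; v].
Proof.
move=> auv; rewrite (bigD1 (u, v)) //= eqxx mulr1 big1 ?addr0 // => e /andP[_ /negbTE->].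
by rewrite mulr0.
Qed.

Lemma path_weight2 w a p b : path (adj T) a p -> last a p = b -> uniq (a :: p) ->
  path_weight w a p *+ 2 =
  \sum_(e : vt T * vt T | adj T e.1 e.2)
     w [set e.1; e.2] * ((a \in branch e.1 e.2) (+) (b \in branch e.1 e.2))%:R.
Proof.
elim: p a => [|x p IH] a.
  move=> _ /= <- _; rewrite /path_weight /= big_nil mul0rn big1 // => e _.
  by rewrite addbb mulr0.
move=> /= /andP[aax px] el /andP[an up].
have bx : b \in branch a x by rewrite -el; apply: path_branch.
have axa : adj T x a by rewrite (adj_sym hT).
rewrite /path_weight /= big_cons /= mulrnDl -/(path_weight w x p) (IH x) //.
have -> : w [set a; x] *+ 2 = w [set a; x] + w [set x; a] by rewrite mulr2n [[set x; a]]setUC.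
rewrite -(sum_edge w aax) -(sum_edge w axa) -!big_split /=; apply: eq_bigr => -[u v] /= auv.
rewrite -!mulrDr -!natrD; congr (_ * _%:R).
have [[-> ->]|n1] := eqVneq (u, v) (a, x).
  have [[e]|_] := eqVneq (a, x) (x, a); first by rewrite e (adj_irr hT) in aax.
  by rewrite bx (negbTE (branch_notin hT aax)) branch_refl.
have [[-> ->]|n2] := eqVneq (u, v) (x, a).
  by rewrite (negbTE (branch_notin hT axa)) branch_refl (branchC hT aax) inE bx.
suff -> : (a \in branch u v) = (x \in branch u v) by [].
apply/eqP/negPn/negP=> /(branch_same hT auv aax)[]e; first by rewrite e eqxx in n1.
by case: e n2 => -> ->; rewrite eqxx.
Qed.

Lemma dist_isP w k l r : dist_is w k l r <-> r *+ 2 = dist2 w k l.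
Proof.
have key p : simple_path (leaf T k) (leaf T l) p ->
    path_weight w (leaf T k) p *+ 2 = dist2 w k l.
  case/and3P=> pp /eqP el up; rewrite (path_weight2 w pp el up).
  by apply: eq_bigr => e _; rewrite !in_side.
split=> [[p [sp <-]]|e]; first exact: key.
case/connectP: (adj_connect hT (leaf T k) (leaf T l)) => p0 pp0 el0.
case/shortenP: pp0 el0 => p pp up _ el; exists p.
have sp : simple_path (leaf T k) (leaf T l) p by rewrite /simple_path pp up -el eqxx.
by split=> //; have := key p sp; rewrite -e; lra.
Qed.

Lemma dist2_add w a x y b : dist2 w a x + dist2 w y b =
  \sum_(e : vt T * vt T | adj T e.1 e.2) w [set e.1; e.2] *
    (((a \in side e.1 e.2) (+) (x \in side e.1 e.2)) +
     ((y \in side e.1 e.2) (+) (b \in side e.1 e.2)))%N%:R.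
Proof. by rewrite -big_split; apply: eq_bigr => e _; rewrite natrD mulrDr. Qed.

Lemma weight_ge0 w u v : is_weighting w -> adj T u v -> 0 <= w [set u; v].
Proof. by move=> hw auv; apply: hw; exists u, v. Qed.

Lemma quartet_bool u v x y a b c d : adj T u v -> adj T x y ->
  a \in side u v -> b \in side u v -> c \notin side u v -> d \notin side u v ->
  (a \in side x y) = (b \in side x y) \/ (c \in side x y) = (d \in side x y).
Proof.
move=> auv axy ha hb hc hd.
have cc := compatible_cross (side_compatible hT auv axy).
have hT' (m : X) : m \in setT by rewrite inE.
case: (boolP (a \in side x y)) => ka; case: (boolP (b \in side x y)) => kb; auto;
case: (boolP (c \in side x y)) => kc; case: (boolP (d \in side x y)) => kd; auto.
- by case: (cc a b c d).
- by case: (cc a b d c).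
- by case: (cc b a c d).
- by case: (cc b a d c).
Qed.

Lemma quartet_bool_sep u v x y a b c d : adj T u v -> adj T x y ->
  (a \in side u v) = (b \in side u v) -> (c \in side u v) = (d \in side u v) ->
  (a \in side u v) != (c \in side u v) ->
  (a \in side x y) = (b \in side x y) \/ (c \in side x y) = (d \in side x y).
Proof.
move=> auv axy eab ecd nac; have avu : adj T v u by rewrite (adj_sym hT).
have [ha|ha] := boolP (a \in side u v); rewrite -?eab -?ecd in nac *.
  by apply: (quartet_bool auv axy) => //; rewrite -?eab -?ecd //; case: (c \in _) nac;
    rewrite ha.
have hc : c \in side u v by move: nac; rewrite (negbTE ha); case: (c \in _).
by apply: (quartet_bool avu axy); rewrite (sideC hT) // inE ?negbK -?eab -?ecd.
Qed.

Lemma four_point w a x y b : is_weighting w ->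
  dist2 w a x + dist2 w y b < dist2 w a y + dist2 w x b ->
  dist2 w a b + dist2 w x y = dist2 w a y + dist2 w x b.
Proof.
move=> hw; rewrite !dist2_add => lt.
pose sep (e : vt T * vt T) := [&& adj T e.1 e.2,
  (a \in side e.1 e.2) == (x \in side e.1 e.2), (y \in side e.1 e.2) == (b \in side e.1 e.2) &
  (a \in side e.1 e.2) != (y \in side e.1 e.2)].
have [/existsP[[u v] /and4P[/= auv /eqP eax /eqP eyb nay]]|/existsPn nsep] := boolP [exists e, sep e].
  apply: eq_bigr => -[p q] /= apq; congr (_ * _%:R).
  by case: (quartet_bool_sep auv apq eax eyb nay) => ->; [rewrite addnC|];
    case: (_ \in _); case: (_ \in _); case: (_ \in _).
move: lt; rewrite ltNge => /negP[]; apply: ler_sum => -[u v] /= auv.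
apply: ler_wpM2l; first exact: weight_ge0.
rewrite ler_nat; have := nsep (u, v); rewrite /sep /= auv /=.
by case: (a \in _); case: (x \in _); case: (y \in _); case: (b \in _).
Qed.

Lemma edge_lt w u v a x y b : is_weighting w -> adj T u v -> w [set u; v] != 0 ->
  a \in side u v -> x \in side u v -> y \notin side u v -> b \notin side u v ->
  dist2 w a x + dist2 w y b < dist2 w a y + dist2 w x b.
Proof.
move=> hw auv wn ha hx hy hb; rewrite !dist2_add.
rewrite (bigD1 (u, v)) //= [ltRHS](bigD1 (u, v)) //=; apply: ltr_leD.
  rewrite ha hx (negbTE hy) (negbTE hb) /= mulr0 mulr_gt0 // lt_def wn.
  exact: weight_ge0.
apply: ler_sum => -[p q] /= /andP[apq _]; apply: ler_wpM2l; first exact: weight_ge0.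
rewrite ler_nat; case: (quartet_bool auv apq ha hx hy hb) => ->;
  by case: (_ \in _); case: (_ \in _); case: (_ \in _).
Qed.

Lemma clus_lt w A a x y b : proper_weighting w -> A \in clus T ->
  a \in A -> x \in A -> y \notin A -> b \notin A -> a != x -> y != b ->
  dist2 w a x + dist2 w y b < dist2 w a y + dist2 w x b.
Proof.
move=> [hw pw] /clusP[u [v [auv ->]]] ha hx hy hb ax yb.
have avu : adj T v u by rewrite (adj_sym hT).
apply: (edge_lt hw auv) => //; apply: pw => //.
  by apply: (side_card hT avu); apply/card_gt1P; exists y, b; rewrite (sideC hT) // !in_setC.
by apply: (side_card hT auv); apply/card_gt1P; exists a, x.
Qed.

(* Quadruples [a1, a2 | b1, b2] across the cluster [A] such that no other
   cluster contributes to [d(a1,b1) + d(a2,b2) - d(a1,a2) - d(b1,b2)]. *)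
Definition isolating (C : {set {set X}}) (A : {set X}) (a1 a2 b1 b2 : X) : Prop :=
  [/\ a1 \in A, a2 \in A, b1 \notin A, b2 \notin A &
    forall B, B \in C -> B != A -> B != ~: A ->
      (((a1 \in B) (+) (b1 \in B)) + ((a2 \in B) (+) (b2 \in B)) =
       ((a1 \in B) (+) (a2 \in B)) + ((b1 \in B) (+) (b2 \in B)))%N].

Lemma isolating_edge w u v a1 a2 b1 b2 : adj T u v ->
  isolating (clus T) (side u v) a1 a2 b1 b2 ->
  (dist2 w a1 b1 + dist2 w a2 b2) - (dist2 w a1 a2 + dist2 w b1 b2) = w [set u; v] *+ 4.
Proof.
move=> auv [h1 h2 k1 k2 iso]; have avu : adj T v u by rewrite (adj_sym hT).
have -> : w [set u; v] *+ 4 = (w [set u; v] + w [set v; u]) *+ 2.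
  by rewrite [[set v; u]]setUC -mulr2n -mulrnA.
rewrite !dist2_add -(sum_edge w auv) -(sum_edge w avu) -big_split /= -sumrMnl -sumrB /=.
apply: eq_bigr => -[p q] /= apq.
have neq (n m : vt T) : adj T n m -> (p, q) != (n, m) -> side p q != side n m.
  by move=> anm; apply: contra => /eqP/(side_inj hT apq anm)->.
have [[-> ->]|n1] := eqVneq (p, q) (u, v).
  have [[e]|_] := eqVneq (u, v) (v, u); first by rewrite e (adj_irr hT) in auv.
  by rewrite h1 h2 (negbTE k1) (negbTE k2) /=; lra.
have [[-> ->]|n2] := eqVneq (p, q) (v, u).
  by rewrite (sideC hT auv) !in_setC h1 h2 (negbTE k1) (negbTE k2) /=; lra.
rewrite -mulrBr iso ?clus_side //; [|exact: neq|].
  by rewrite subrr !mulr0 addr0 mul0rn.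
by rewrite -(sideC hT auv) neq.
Qed.

Lemma isolating_notin w A a1 a2 b1 b2 : A \notin clus T ->
  isolating (clus T) A a1 a2 b1 b2 ->
  (dist2 w a1 b1 + dist2 w a2 b2) - (dist2 w a1 a2 + dist2 w b1 b2) = 0.
Proof.
move=> An [h1 h2 k1 k2 iso]; rewrite !dist2_add -sumrB big1 // => -[p q] /= apq.
rewrite -mulrBr iso ?clus_side ?subrr ?mulr0 //.
  by apply: contraNneq An => <-; rewrite clus_side.
by apply: contraNneq An => e; rewrite -[A]setCK -e (clusC hT) // clus_side.
Qed.

End Distances.

Section Isolating.
Variables (X : finType) (C : {set {set X}}).
Hypothesis bsC : binary_splits setT C.

Lemma bs_halves A : A \in C -> exists a1 a2, [/\ a1 \in A, a2 \in A &
  forall B, B \in C -> B \subset A -> B != A -> a1 \in B -> a2 \notin B].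
Proof.
move=> hA; have [|c1] := leqP #|A| 1.
  have [a aA] := set0Pn _ (bs_neq0 bsC hA) => /card_le1_eqP le1; exists a, a; split=> //.
  move=> B _ sB nB aB; case/negP: nB; rewrite eqEsubset sB; apply/subsetP=> z zA.
  by rewrite (le1 a z).
have [B1 [B2 [h1 h2 e d]]] := bs_split bsC hA c1.
have [a1 a1B] := set0Pn _ (bs_neq0 bsC h1); have [a2 a2B] := set0Pn _ (bs_neq0 bsC h2).
exists a1, a2; rewrite e !inE a1B a2B orbT; split=> // B hB sB nB b1; apply/negP=> b2.
have pr : B1 :|: B2 \proper setT.
  by rewrite -e properE subsetT; have [z _ zA] := bs_outP bsC hA; apply/subsetPn; exists z.
case: (bs_split_compat bsC h1 h2 hB d pr sB nB) => /subsetP s.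
  exact: disjointF d (s _ b2) a2B.
exact: disjointF d a1B (s _ b1).
Qed.

Lemma isolating_exists A : A \in C -> exists a1 a2 b1 b2, isolating C A a1 a2 b1 b2.
Proof.
move=> hA; have hA' := bs_compl bsC hA; rewrite setTD in hA'.
have [a1 [a2 [h1 h2 ha]]] := bs_halves hA; have [b1 [b2 [k1 k2 hb]]] := bs_halves hA'.
exists a1, a2, b1, b2; split; rewrite ?inE in k1 k2 * => //.
move=> B hB nB nB'; have hB' := bs_compl bsC hB; rewrite setTD in hB'.
have nBC : ~: B != ~: A by rewrite (inj_eq (@setC_inj _)).
have nBC' : ~: B != A by apply: contraNneq nB' => <-; rewrite setCK.
have out z (D E : {set X}) : D \subset E -> z \notin E -> (z \in D) = false.
  by move=> s; apply: contraNF => /(subsetP s).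
case/or4P: (bs_compat bsC hB hA) => s.
- rewrite !(out b1 B A, out b2 B A) //; have := ha B hB s nB.
  by case: (a1 \in B) => [/(_ isT)/negbTE->|_] //; case: (a2 \in B).
- rewrite !(subsetP s _ h1, subsetP s _ h2); have := hb (~: B) hB'.
  rewrite setCS nBC !inE => /(_ s isT).
  by case: (b1 \in B) => [_|/(_ isT)]; rewrite ?negbK; case: (b2 \in B).
- have sB : B \subset ~: A by rewrite -disjoints_subset.
  rewrite !(out a1 B (~: A), out a2 B (~: A)) // ?inE ?negbK //; have := hb B hB sB nB'.
  by case: (b1 \in B) => [/(_ isT)/negbTE->|_] //; case: (b2 \in B).
- have sB : ~: B \subset A.
    by apply/subsetP=> z; rewrite inE => zB; have := subsetP s z; rewrite !inE (negbTE zB) /= => ->.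
  have inB z : z \notin A -> z \in B.
    by move=> zA; apply/negPn/negP=> zB; rewrite (subsetP sB) ?inE in zA.
  rewrite (inB b1) // (inB b2) //; have := ha (~: B) hB' sB nBC'; rewrite !inE.
  by case: (a1 \in B) => [_|/(_ isT)]; rewrite ?negbK; case: (a2 \in B).
Qed.

End Isolating.

Section Isometries.
Variables (X : finType) (R : realType) (T T' : Xtree X).
Hypotheses (hT : is_Xtree T) (hT' : is_Xtree T').
Variables (w : weighting R T) (w' : weighting R T').
Hypotheses (pw : proper_weighting w) (pw' : proper_weighting w').
Hypotheses (X2 : 1 < #|X|) (fr : fully_resolved T).
Local Open Scope ring_scope.

Lemma cords_isometric f : stable_on (clus T) f ->
  Lisometric (cords setT (clus T) f) w w' ->
  forall k l, dist2 w k l = dist2 w' k l.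
Proof.
move=> stf iso; have bsC := clus_splits hT X2 fr; set L := cords _ _ _ in iso.
have cX : (1 < #|[set: X]|)%N by rewrite cardsT.
have [ms [ums mem_ms sh]] := cords_shelling bsC stf cX.
pose ok (c : {set X}) := forall k l, c = [set k; l] -> dist2 w k l = dist2 w' k l.
have okL c : c \in L -> ok c.
  move=> cL k l ec; have [<-|kl] := eqVneq k l; first by rewrite !dist2_refl.
  rewrite ec in cL; have := iso k l kl cL (dist2 w k l / 2).
  have h : dist2 w k l / 2 *+ 2 = dist2 w k l by lra.
  by rewrite !dist_isP // h => -[e _]; apply: e.
have okms mu : (mu < size ms)%N -> ok (nth set0 ms mu).
  have [n] := ubnP mu; elim: n mu => // n IH mu ltn ltmu.
  have [a [b [x [y [emu u [_ [A hA hq] hc]]]]]] := sh _ ltmu.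
  move: u; rewrite /= !inE !negb_or !andbT => /and3P[/and3P[nab nax nay] /andP[nbx nby] nxy].
  have okc k l : k != l -> [set k; l] \subset [set a; b; x; y] -> [set k; l] != [set a; b] ->
      dist2 w k l = dist2 w' k l.
    move=> kl s ne; have ckl : is_cord [set k; l] by rewrite /is_cord cards2 kl.
    case/orP: (hc _ ckl s ne) => [/okL|/(nthP set0)[i]]; first by apply.
    rewrite size_take ltmu => lti; rewrite nth_take // => ei.
    by apply: (IH i) => //; [exact: leq_trans lti ltn | exact: ltn_trans lti ltmu].
  have ne k l : k \notin [set a; b] -> [set k; l] != [set a; b].
    by apply: contra => /eqP<-; rewrite !inE eqxx.
  have xn : x \notin [set a; b] by rewrite !inE negb_or ![x == _]eq_sym nax.
  have yn : y \notin [set a; b] by rewrite !inE negb_or ![y == _]eq_sym nay.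
  have ss k l : k \in [set a; b; x; y] -> l \in [set a; b; x; y] ->
      [set k; l] \subset [set a; b; x; y].
    by move=> h1 h2; rewrite subUset !sub1set h1 h2.
  have eax : dist2 w a x = dist2 w' a x.
    by rewrite ![dist2 _ a _]dist2C; apply: okc; [by rewrite // eq_sym | by apply: ss; rewrite !inE eqxx ?orbT | exact: ne].
  have eyb : dist2 w y b = dist2 w' y b.
    by apply: okc; [by rewrite // eq_sym | by apply: ss; rewrite !inE eqxx ?orbT | exact: ne].
  have eay : dist2 w a y = dist2 w' a y.
    by rewrite ![dist2 _ a _]dist2C; apply: okc; [by rewrite // eq_sym | by apply: ss; rewrite !inE eqxx ?orbT | exact: ne].
  have exb : dist2 w x b = dist2 w' x b.
    by apply: okc; [by rewrite // eq_sym | by apply: ss; rewrite !inE eqxx ?orbT | exact: ne].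
  have exy : dist2 w x y = dist2 w' x y.
    by apply: okc; [by [] | by apply: ss; rewrite !inE eqxx ?orbT | exact: ne].
  case/and4P: hq => aA xA yA bA.
  have lt : dist2 w a x + dist2 w y b < dist2 w a y + dist2 w x b.
    by apply: (clus_lt hT pw hA) => //; rewrite eq_sym.
  have lt' : dist2 w' a x + dist2 w' y b < dist2 w' a y + dist2 w' x b.
    by rewrite -eax -eyb -eay -exb.
  have e1 := four_point hT pw.1 lt; have e2 := four_point hT' pw'.1 lt'.
  have eab : dist2 w a b = dist2 w' a b by lra.
  move=> k l; rewrite emu => /setP e.
  have := e k; have := e l; rewrite !inE !eqxx orbT /=.
  have [<-|kl] := eqVneq k l; first by rewrite !dist2_refl.
  case/orP=> /eqP ->; case/orP=> /eqP ek; rewrite ek ?dist2_refl //.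
  by rewrite dist2C [RHS]dist2C.
move=> k l; have [<-|kl] := eqVneq k l; first by rewrite !dist2_refl.
have ckl : is_cord [set k; l] by rewrite /is_cord cards2 kl.
have [cL|cn] := boolP ([set k; l] \in L); first exact: okL cL _ _ erefl.
have : [set k; l] \in ms by rewrite mem_ms ckl subsetT cn.
by case/(nthP set0)=> i lti ei; apply: (okms i lti).
Qed.

Hypothesis iso : forall k l, dist2 w k l = dist2 w' k l.

Lemma isometric_clus : clus T' = clus T.
Proof.
have bsC := clus_splits hT X2 fr.
have sub : clus T' \subset clus T.
  apply/subsetP=> A hA; apply: (bs_maximal bsC); first exact: clus_neq0 hA.
    rewrite properT; have /set0Pn[z] := clus_neq0 hT' (clusC hT' hA); rewrite inE.
    by apply: contraNneq => ->; rewrite inE.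
  move=> B hB; apply/or4P.
  have [|/subsetPn[b bA bB]] := boolP (A \subset B); first by constructor 1.
  have [|/subsetPn[c cB cA]] := boolP (B \subset A); first by constructor 2.
  have [|/pred0Pn[a /andP[/= aA aB]]] := boolP [disjoint A & B]; first by constructor 3.
  have [|/subsetPn[d _]] := boolP (setT \subset A :|: B); first by constructor 4.
  rewrite inE negb_or => /andP[dA dB].
  have neq (E : {set X}) p q : p \in E -> q \notin E -> p != q.
    by move=> pE; apply: contraNneq => <-.
  have := clus_lt hT' pw' hA aA bA cA dA (neq _ _ _ aB bB) (neq _ _ _ cB dB).
  have := clus_lt hT pw hB aB cB bB dB (neq _ _ _ aA cA) (neq _ _ _ bA dA).
  rewrite !iso; lra.
apply/eqP; rewrite eqEsubset sub; apply/subsetP=> A hA; apply/negPn/negP=> nA.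
have [a1 [a2 [b1 [b2 hi]]]] := isolating_exists bsC hA.
have hi' : isolating (clus T') A a1 a2 b1 b2.
  by case: hi => h1 h2 k1 k2 hB; split=> // B /(subsetP sub); apply: hB.
move/clusP: (hA) => [u [v [auv eA]]]; have avu : adj T v u by rewrite (adj_sym hT).
rewrite eA in hi; have := isolating_edge hT w auv hi.
rewrite !iso (isolating_notin hT' w' nA hi') => /esym/eqP.
rewrite mulrn_eq0 /=; apply/negP; apply: pw.2 => //; apply/negP=> /leaf_vertexP[l el].
  case/negP: nA; rewrite eA -[side u v]setCK -(sideC hT auv) -el (side_leaf hT) ?el //.
  by apply: (clusC hT'); apply: (clus1 hT').
by case/negP: nA; rewrite eA -el (side_leaf hT) ?el //; apply: (clus1 hT').
Qed.

End Isometries.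

Lemma isometric_weights (X : finType) (R : realType) (T : Xtree X) (w w' : weighting R T) :
  is_Xtree T -> 1 < #|X| -> fully_resolved T ->
  (forall k l, dist2 w k l = dist2 w' k l) -> same_weighting w w'.
Proof.
move=> hT X2 fr iso _ [u [v [auv ->]]]; have bsC := clus_splits hT X2 fr.
have [a1 [a2 [b1 [b2 hi]]]] := isolating_exists bsC (clus_side auv).
have := isolating_edge hT w auv hi; rewrite !iso (isolating_edge hT w' auv hi); lra.
Qed.

(** * Trees with the same clusters *)

Section Orientations.
Variables (X : finType) (T : Xtree X).
Hypothesis hT : is_Xtree T.
Implicit Types (u v p q z : vt T) (A : {set X}) (a b c : X).

Definition around v : {set {set X}} :=
  [set A | [exists e : vt T * vt T,
     [&& adj T e.1 e.2, v \in branch e.1 e.2 & A == side e.1 e.2]]].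

Lemma aroundP v A : reflect (exists p q, [/\ adj T p q, v \in branch p q & A = side p q])
  (A \in around v).
Proof.
rewrite inE; apply: (iffP existsP) => [[[p q] /and3P[/= h1 h2 /eqP h3]]|[p [q [h1 h2 h3]]]].
  by exists p, q.
by exists (p, q); rewrite /= h1 h2 h3 eqxx.
Qed.

Lemma side_around v p q : adj T p q -> (side p q \in around v) = (v \in branch p q).
Proof.
move=> apq; apply/aroundP/idP=> [[p' [q' [a' h /(side_inj hT apq a')[-> ->]]]]//|h].
by exists p, q.
Qed.

Lemma around_clus v A : A \in around v -> A \in clus T.
Proof. by case/aroundP=> p [q [apq _ ->]]; apply: clus_side. Qed.

Lemma around_inj : injective around.
Proof.
move=> u v e; apply/eqP/negPn/negP=> /(exists_nbr hT)[z avz uz].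
by have := side_around u avz; rewrite e side_around // uz (negbTE (branch_notin hT avz)).
Qed.

Lemma adj_around u v : adj T u v = (#|around v :\: around u| == 1).
Proof.
apply/idP/idP=> [auv|/cards1P[A eA]].
  apply/cards1P; exists (side u v); apply/setP=> A; rewrite in_setD in_set1.
  apply/andP/eqP=> [[nu /aroundP[p [q [apq vq eA]]]]|->]; last first.
    by rewrite !side_around // branch_refl branch_notin.
  rewrite eA side_around // in nu; rewrite (adj_sym hT) in auv.
  by have [-> ->] := branch_step auv vq nu.
have inA p q : adj T p q -> v \in branch p q -> u \notin branch p q -> side p q = A.
  by move=> apq vq uq; apply/eqP; rewrite -in_set1 -eA in_setD !side_around // vq uq.
have [e|] := eqVneq v u.
  by have := set11 A; rewrite -eA e setDv inE.
case/(exists_nbr hT)=> z auz vz; have [<-//|zv] := eqVneq z v.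
rewrite eq_sym in zv; have [y azy vy] := exists_nbr hT zv.
have uz := branch_notin hT auz.
have yu : y != u by apply: contraTneq vy => ->; rewrite (branchC hT) // inE negbK.
have uy : u \notin branch z y by apply: contra uz => /(subsetP (branch_sub_nbr hT auz azy yu)).
have [e _] := side_inj hT auz azy (etrans (inA _ _ auz vz uz) (esym (inA _ _ azy vy uy))).
by rewrite e (adj_irr hT) in auz.
Qed.

Lemma around_leaf a A : A \in clus T -> (A \in around (leaf T a)) = (a \in A).
Proof. by case/clusP=> p [q [apq ->]]; rewrite side_around // in_side. Qed.

Definition majority a b c A :=
  [|| (a \in A) && (b \in A), (a \in A) && (c \in A) | (b \in A) && (c \in A)].

Lemma majorityC a b c A : majority a b c (~: A) = ~~ majority a b c A.
Proof. by rewrite /majority !inE; case: (a \in A); case: (b \in A); case: (c \in A). Qed.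

Lemma around_interior v : ~~ is_leaf_vertex v -> exists a b c,
  forall A, A \in clus T -> (A \in around v) = majority a b c A.
Proof.
move=> nl; have [z1 [_ [a1 _ _ _ _]]] := interior_nbrs hT v nl.
have [z2 [z3 [a2 a3 n23 n21 n31]]] := interior_nbrs hT z1 nl.
have [a ha] := side_neq0 hT a1; have [b hb] := side_neq0 hT a2.
have [c hc] := side_neq0 hT a3; exists a, b, c.
have two x y (k l : X) p q : v \notin branch p q -> adj T v x -> adj T v y -> x != y ->
    leaf T k \in branch v x -> leaf T l \in branch v y ->
    ~~ ((k \in side p q) && (l \in side p q)).
  move=> vn avx avy xy kx ly; rewrite !in_side; apply/negP=> /andP[kp lp].
  apply: (disjointF (branch_disjoint hT avx avy xy) _ ly).
  exact: (subsetP (branch_sub_of_notin hT avx vn kp kx)).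
have out p q : v \notin branch p q -> ~~ majority a b c (side p q).
  move=> vn; rewrite /majority !negb_or (two z1 z2) 1?eq_sym // (two z1 z3) 1?eq_sym //=.
  by rewrite (two z2 z3).
move=> _ /clusP[p [q [apq ->]]]; rewrite side_around //.
have aqp : adj T q p by rewrite (adj_sym hT).
have [vp|/out/negbTE->//] := boolP (v \in branch p q).
apply/esym; rewrite -[side p q]setCK -(sideC hT apq) majorityC; apply: out.
by rewrite (branchC hT apq) inE negbK.
Qed.

(* Orient every edge towards the majority of [a, b, c]; a vertex lying on the
   head side of as many edges as possible is a sink. *)
Lemma around_majority a b c : exists v,
  forall A, A \in clus T -> (A \in around v) = majority a b c A.
Proof.
pose M v := [set A in around v | majority a b c A].
have inM z A : (A \in M z) = (A \in around z) && majority a b c A by rewrite /M in_set.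
have [v _ maxv] := @arg_maxnP _ (leaf T a) xpredT (fun v => #|M v|) isT.
exists v.
have out z : adj T v z -> ~~ majority a b c (side v z).
  move=> avz; apply/negP=> mz; suff lt : #|M v| < #|M z| by have := maxv z isT; rewrite /= leqNgt lt.
  apply: proper_card; apply/properP; split; last first.
    exists (side v z); rewrite inM mz andbT side_around ?branch_refl //.
    exact: branch_notin.
  apply/subsetP=> A; rewrite !inM => /andP[].
  case/aroundP=> p [q [apq vq ->]] mA; rewrite mA andbT side_around //.
  apply/negPn/negP=> zn; have [ev ez] := branch_step avz vq zn.
  by move: mA; rewrite -ev -ez (sideC hT avz) majorityC mz.
have inb p q : adj T p q -> majority a b c (side p q) -> v \in branch p q.
  move=> apq m; apply/negPn/negP=> vn.
  have [k ks] : exists k, k \in side p q.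
    by case/or3P: m => /andP[h _]; [exists a | exists a | exists b].
  have kv : leaf T k != v by apply: contraNneq vn => <-; rewrite -in_side.
  have [z avz kz] := exists_nbr hT kv; rewrite in_side in ks.
  have s := branch_sub_of_notin hT avz vn ks kz.
  case/negP: (out z avz); apply: contraTT m.
  have mono k' : k' \in side p q -> k' \in side v z.
    by rewrite !in_side; apply: (subsetP s).
  move=> nm; apply: contra nm => /or3P[]/andP[h1 h2]; apply/or3P;
    [constructor 1|constructor 2|constructor 3]; by rewrite !mono.
move=> _ /clusP[p [q [apq ->]]]; rewrite side_around //; apply/idP/idP; last exact: inb.
move=> vp; apply/negPn/negP; rewrite -majorityC -(sideC hT apq) => /inb.
by rewrite (adj_sym hT) => /(_ apq); rewrite (branchC hT apq) inE vp.
Qed.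

End Orientations.

Lemma around_transfer (X : finType) (T T' : Xtree X) : is_Xtree T -> is_Xtree T' ->
  clus T = clus T' -> forall v : vt T, exists v' : vt T', around v' == around v.
Proof.
move=> hT hT' eC v.
have eq (v' : vt T') : (forall A, A \in clus T -> (A \in around v') = (A \in around v)) ->
    exists v' : vt T', around v' == around v.
  move=> h; exists v'; apply/eqP/setP=> A; have [hA|nA] := boolP (A \in clus T); first exact: h.
  apply/idP/idP=> hA; case/negP: nA; last exact: around_clus hA.
  by rewrite eC; apply: around_clus hA.
have [/leaf_vertexP[a e]|nl] := boolP (is_leaf_vertex v).
  by apply: (eq (leaf T' a)) => A hA; rewrite -e !around_leaf // -eC.
have [a [b [c hv]]] := around_interior hT nl.
have [v' hv'] := around_majority hT' a b c.
by apply: (eq v') => A hA; rewrite hv // hv' // -eC.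
Qed.

Lemma same_clus_equiv (X : finType) (T T' : Xtree X) : is_Xtree T -> is_Xtree T' ->
  clus T = clus T' -> equiv_Xtree T T'.
Proof.
move=> hT hT' eC; have h := around_transfer hT hT' eC.
have h' := around_transfer hT' hT (esym eC).
pose F v := xchoose (h v); pose G v := xchoose (h' v).
have FE v : around (F v) = around v by apply/eqP; apply: (xchooseP (h v)).
have GE v : around (G v) = around v by apply/eqP; apply: (xchooseP (h' v)).
exists F; split.
- exists G => v; first by apply: (around_inj hT); rewrite GE FE.
  by apply: (around_inj hT'); rewrite FE GE.
- move=> a; apply: (around_inj hT'); rewrite FE; apply/setP=> A.
  have [hA|nA] := boolP (A \in clus T); first by rewrite !around_leaf // -eC.
  apply/idP/idP=> hA; case/negP: nA; first exact: around_clus hA.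
  by rewrite eC; apply: around_clus hA.
- by move=> u v; rewrite !adj_around // !FE.
Qed.

(** * Stable triplet covers *)

Lemma path_stays (X : finType) (T : Xtree X) (u v a : vt T) (p : seq (vt T)) :
  is_Xtree T -> adj T u v -> path (adj T) a p -> uniq (a :: p) ->
  a \in branch u v -> last a p \in branch u v -> {subset a :: p <= branch u v}.
Proof.
move=> hT auv; elim: p a => [|x p IH] a /=; first by move=> _ _ ha _ z; rewrite inE => /eqP->.
move=> /andP[aax px] /andP[an up] ha hl z; rewrite inE => /orP[/eqP->//|].
have [hx|nx] := boolP (x \in branch u v); first exact: IH.
have [ea ex] := branch_step aax ha nx.
by move: hl (path_branch px an); rewrite ea ex (branchC hT auv) in_setC => ->.
Qed.

Lemma clus_quartet (X : finType) (T : Xtree X) (A : {set X}) a x y b : is_Xtree T ->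
  A \in clus T -> a \in A -> x \in A -> y \notin A -> b \notin A -> quartet T a x y b.
Proof.
move=> hT /clusP[u [v [auv ->]]]; rewrite !in_side => ha hx hy hb p q.
have avu : adj T v u by rewrite (adj_sym hT).
move=> /and3P[pp /eqP ep up] /and3P[pq /eqP eq uq].
have sp := path_stays hT auv pp up ha; have sq := path_stays hT avu pq uq.
rewrite ep in sp; rewrite eq !(branchC hT auv) !in_setC in sq.
apply/hasPn=> z /(sp hx) zp; apply/negP=> /(sq hy hb).
by rewrite in_setC zp.
Qed.

Lemma kernel_weights (R : fieldType) (I J : finType) (E : {set I}) (L : {set J})
    (N : I -> J -> R) : #|L| < #|E| -> exists k : I -> R,
  (exists2 s, s \in E & k s != 0%R) /\
  forall c, c \in L -> (\sum_(s in E) k s * N s c)%R = 0%R.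
Proof.
move=> lt; pose M : 'M[R]_(#|E|, #|L|) := (\matrix_(i, j) N (enum_val i) (enum_val j))%R.
have : kermx M != 0%R.
  rewrite kermx_eq0 /row_free; apply: contraL lt => /eqP<-.
  by rewrite -leqNgt rank_leq_col.
case/rowV0Pn=> v /sub_kermxP vM /rV0Pn[i vi].
pose k s := (if s \in E then v 0 (enum_rank_in (enum_valP i) s) else 0)%R.
have kE j : k (enum_val j) = v 0%R j by rewrite /k enum_valP enum_valK_in.
exists k; split; first by exists (enum_val i); rewrite ?enum_valP ?kE.
move=> c cL; rewrite big_enum_val /=.
have := congr1 (fun m : 'rV_ _ => m 0%R (enum_rank_in cL c)) vM; rewrite !mxE => e; rewrite -[RHS]e.
by apply: eq_bigr => j _; rewrite kE mxE enum_rankK_in.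
Qed.

Section Minimality.
Variables (X : finType) (R : realType) (T : Xtree X).
Hypotheses (hT : is_Xtree T) (X2 : 1 < #|X|).

Definition edges : {set {set vt T}} :=
  [set [set e.1; e.2] | e : vt T * vt T & adj T e.1 e.2].

Lemma edgesP s : reflect (is_edge s) (s \in edges).
Proof.
apply: (iffP imsetP) => [[[u v]]|[u [v [auv ->]]]].
  by rewrite inE /= => auv ->; exists u, v.
by exists (u, v); rewrite ?inE.
Qed.

Lemma card_edges : #|clus T| <= 2 * #|edges|.
Proof.
have [l _] : exists l : X, true by case/card_gt1P: X2 => l _; exists l.
pose pk s := odflt (leaf T l, leaf T l)
  [pick e : vt T * vt T | adj T e.1 e.2 && (s == [set e.1; e.2])].
pose g1 s := side (pk s).1 (pk s).2; pose g2 s := side (pk s).2 (pk s).1.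
have sub : clus T \subset (g1 @: edges) :|: (g2 @: edges).
  apply/subsetP=> _ /clusP[u [v [auv ->]]].
  have hE : [set u; v] \in edges by apply/edgesP; exists u, v.
  have [[eu ev]|[eu ev]] : ((pk [set u; v]).1 = u /\ (pk [set u; v]).2 = v) \/
      ((pk [set u; v]).1 = v /\ (pk [set u; v]).2 = u).
    rewrite /pk; case: pickP => [[p q] /= /andP[apq /eqP e]|/(_ (u, v))]; last first.
      by rewrite /= auv eqxx.
    have npq := adj_neq hT apq; have nuv := adj_neq hT auv.
    have := set21 u v; have := set22 u v; rewrite e !inE.
    case/orP=> /eqP ev; case/orP=> /eqP eu; rewrite eu ev ?eqxx // in nuv *; auto.
  - by rewrite inE; apply/orP; left; apply/imsetP; exists [set u; v]; rewrite // /g1 eu ev.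
  - by rewrite inE; apply/orP; right; apply/imsetP; exists [set u; v]; rewrite // /g2 eu ev.
apply: leq_trans (subset_leq_card sub) _; rewrite cardsU.
apply: leq_trans (leq_subr _ _) _; rewrite mul2n -addnn.
by apply: leq_add; apply: leq_imset_card.
Qed.

Definition separated (A c : {set X}) := ~~ [disjoint c & A] && ~~ (c \subset A).

Lemma separated2 A x y : separated A [set x; y] = (x \in A) (+) (y \in A).
Proof.
rewrite /separated subUset !sub1set -setI_eq0 setIUl.
rewrite setU_eq0 !setI_eq0 !disjoints1.
by case: (x \in A); case: (y \in A).
Qed.

Lemma dist2_edges (w : weighting R T) x y : dist2 w x y =
  (\sum_(s in edges) w s * \sum_(e : vt T * vt T | adj T e.1 e.2 && ([set e.1; e.2] == s))
      (separated (side e.1 e.2) [set x; y])%:R)%R.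
Proof.
rewrite /dist2 (partition_big (fun e : vt T * vt T => [set e.1; e.2]) (mem edges)) /=.
  apply: eq_bigr => s _; rewrite mulr_sumr; apply: eq_bigr => e /andP[_ /eqP->].
  by rewrite separated2.
by move=> e ae; apply/edgesP; exists e.1, e.2.
Qed.

Lemma edge_weight_lasso_card (L : {set {set X}}) :
  edge_weight_lasso R L T -> #|edges| <= #|L|.
Proof.
move=> lasso; rewrite leqNgt; apply/negP=> lt.
pose N s c : R := (\sum_(e : vt T * vt T | adj T e.1 e.2 && ([set e.1; e.2] == s))
  (separated (side e.1 e.2) c)%:R)%R.
have [k [[s0 s0E ks0] kN]] := kernel_weights N lt.
pose K : R := (1 + \sum_(s in edges) `|k s|)%R.
have K1 s : s \in edges -> (`|k s| + 1 <= K)%R.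
  move=> sE; rewrite /K addrC lerD2l (bigD1 s) //= lerDl.
  by apply: sumr_ge0.
have Kp : (0 < K)%R by have := K1 _ s0E; have := normr_ge0 (k s0); lra.
have Kk s : s \in edges -> (0 < K + k s)%R.
  by move=> /K1; have := ler_norm (- k s)%R; rewrite normrN; lra.
pose w : weighting R T := fun _ => K; pose w' : weighting R T := fun s => (K + k s)%R.
have edge u v : adj T u v -> [set u; v] \in edges by move=> a; apply/edgesP; exists u, v.
have pw : proper_weighting w by split=> [s _|u v _ _ _]; rewrite /w ?ltW ?gt_eqF.
have pw' : proper_weighting w'.
  split=> [s /edgesP/Kk/ltW //|u v a _ _]; by rewrite /w' gt_eqF // Kk // edge.
have eqs : same_weighting w w'.
  apply: lasso => // x y _ xyL r; rewrite !dist_isP //.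
  suff -> : dist2 w' x y = dist2 w x y by [].
  rewrite !dist2_edges /w' -[RHS]addr0 -[X in _ = (_ + X)%R](kN _ xyL) -big_split /=.
  by apply: eq_bigr => s _; rewrite mulrDl.
have := eqs s0; rewrite /w /w' => /(_ (elimT (edgesP _) s0E)) e.
by move/eqP: ks0; apply; lra.
Qed.

End Minimality.

Section StableCover.
Variables (X : finType) (R : realType) (T : Xtree X) (f : {set X} -> X).
Hypotheses (hT : is_Xtree T) (X2 : 1 < #|X|) (fr : fully_resolved T).
Hypothesis stf : stable_on (clus T) f.

Let L := cords setT (clus T) f.
Let bsC : binary_splits setT (clus T). Proof. exact: clus_splits. Qed.
Let cX : 1 < #|[set: X]|. Proof. by rewrite cardsT. Qed.

Lemma cover_strong_lasso : strong_lasso R L T.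
Proof.
split=> [w w' pw pw' iso|T' w w' hT' pw pw' iso].
  apply: isometric_weights => //; exact: cords_isometric iso.
have e := cords_isometric hT hT' pw pw' X2 fr stf iso.
by apply: same_clus_equiv => //; rewrite (isometric_clus hT hT' pw pw' X2 fr e).
Qed.

Lemma cover_card : #|L| = 2 * #|X| - 3.
Proof. by rewrite /L card_cords // cardsT. Qed.

Lemma cover_minimal : minimal_strong_lasso R L T.
Proof.
split; first exact: cover_strong_lasso.
move=> L' /proper_card lt [/(edge_weight_lasso_card hT) le _].
have := card_edges hT X2; have := card_clusters bsC stf cX.
by move: lt; rewrite cover_card cardsT; lia.
Qed.

Lemma cover_twod_tree : twod_tree L.
Proof.
have [x1 [x2 [s' [us sX x12 cnt]]]] := cords_twod_tree bsC stf cX.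
by exists x1, x2, s'; split=> // x; rewrite sX inE.
Qed.

Lemma cover_shellable : shellable_lasso L T.
Proof.
split; first by move=> c /(cords_cord bsC stf)/andP[].
split; first by move=> x; apply: cords_cover.
have [ms [ums mem_ms sh]] := cords_shelling bsC stf cX.
exists ms; split=> // [c|mu ltmu]; first by rewrite mem_ms subsetT.
have [a [b [x [y [emu u [_ [A hA /and4P[aA xA yA bA]] hc]]]]]] := sh _ ltmu.
by exists a, b, x, y; split=> //; apply: clus_quartet hA _ _ _ _.
Qed.

End StableCover.

Theorem theorem1 (R : realType) (X : finType) (T : Xtree X) (L : {set {set X}}) :
  (3 <= #|X|)%N -> is_Xtree T -> fully_resolved T -> stable_triplet_cover L T ->
  [/\ twod_tree L,
      shellable_lasso L T /\ strong_lasso R L T &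
      #|L| = (2 * #|X| - 3)%N /\ minimal_strong_lasso R L T].
Proof.
move=> X3 hT fr [f [stf ->]]; have X2 : 1 < #|X| by apply: ltnW.
rewrite (L_Tf_cords hT X3 fr stf); split.
- exact: cover_twod_tree.
- by split; [apply: cover_shellable | apply: cover_strong_lasso].
- by split; [apply: cover_card | apply: cover_minimal].
Qed.
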